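(* Let $X$ be a dendrite and let $f\colon X\to X$ be a continuous map. Then the following are equivalent: (e$'$) $X$ contains an $f$-expanding arc; (f$'$) for some $n\in\mathbb N$, the set $\mathrm{Fix}(f^n)$ is disconnected; (j$'$) there exist points $x,y\in X$ and $n\in\mathbb N$ such that $x=f^n(x)$, $y\neq f^n(y)$, and $y\in x f^n(y)$, where $x f^n(y)$ denotes the arc in $X$ joining $x$ and $f^n(y)$.
   Context: $\mathbb N=\{1,2,3,\dots\}$; $f^n$ denotes the $n$-fold iterate of $f$. A continuum is a (nonempty) compact connected metric space. A dendrite is a locally connected continuum that contains no simple closed curve (no subspace homeomorphic to the unit circle). An arc is a space homeomorphic to $[0,1]$. In a dendrite $X$, for distinct $a,b\in X$, $ab$ denotes the unique arc in $X$ with endpoints $a$ and $b$ (with $aa=\{a\}$). An arc $A\subseteq X$ is $f$-expanding if there is $n\in\mathbb N$ with $A\subsetneq f^n[A]$. $\mathrm{Fix}(g)=\{z\in X: g(z)=z\}$. *)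

(* Defs.v *)
From HB Require Import structures.
From mathcomp Require Import all_boot all_order all_algebra.
From mathcomp Require Import all_classical all_reals all_analysis.

Set Implicit Arguments.
Unset Strict Implicit.
Unset Printing Implicit Defensive.

Import Order.TTheory GRing.Theory Num.Theory.
Import numFieldNormedType.Exports.

Local Open Scope classical_set_scope.
Local Open Scope ring_scope.

(* [h] and [k] restrict to mutually inverse homeomorphisms between the
   subspaces [A] and [B]; their values outside [A] and [B] are irrelevant. *)
Definition homeomorphism_on (T U : topologicalType) (A : set T) (B : set U)
    (h : T -> U) (k : U -> T) : Prop :=
  [/\ {within A, continuous h}, {within B, continuous k},
      (forall x, A x -> B (h x) /\ k (h x) = x) &
      (forall y, B y -> A (k y) /\ h (k y) = y)].

Definition homeomorphic (T U : topologicalType) (A : set T) (B : set U) : Prop :=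
  exists (h : T -> U) (k : U -> T), homeomorphism_on A B h k.

Definition unit_circle (R : realType) : set (R * R) :=
  [set p | p.1 ^+ 2 + p.2 ^+ 2 = 1].

Definition is_arc (R : realType) (X : topologicalType) (A : set X) : Prop :=
  homeomorphic `[0 : R, 1]%classic A.

Definition is_simple_closed_curve (R : realType) (X : topologicalType)
    (A : set X) : Prop :=
  homeomorphic (@unit_circle R) A.

Definition is_arc_between (R : realType) (X : topologicalType) (a b : X)
    (A : set X) : Prop :=
  exists (h : R -> X) (k : X -> R),
    [/\ homeomorphism_on `[0 : R, 1]%classic A h k, h 0 = a & h 1 = b].

(* Meaningful when [X] is uniquely arcwise connected, as dendrites are: [xget]
   then returns the only arc from [a] to [b]. Its default [set0] is a junk value
   for spaces with no such arc. *)
Definition arc_joining (R : realType) (X : topologicalType) (a b : X) : set X :=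
  if a == b then [set a] else xget set0 [set A | is_arc_between R a b A].

Definition is_locally_connected (X : topologicalType) : Prop :=
  forall (x : X) (U : set X), nbhs x U ->
    exists V : set X, [/\ open V, V x, connected V & V `<=` U].

Definition is_continuum (R : realType) (X : metricType R) : Prop :=
  [/\ [set: X] !=set0, compact [set: X] & connected [set: X]].

Definition is_dendrite (R : realType) (X : metricType R) : Prop :=
  [/\ is_continuum X, is_locally_connected X &
      ~ exists A : set X, is_simple_closed_curve R A].

Definition is_expanding_arc (R : realType) (X : topologicalType) (f : X -> X)
    (A : set X) : Prop :=
  is_arc R A /\ exists n : nat, (0 < n)%N /\ A `<` (iter n f @` A).

Definition fixed_points (X : Type) (g : X -> X) : set X := [set z | g z = z].

(* Main.v *)
Require Import Defs.
From HB Require Import structures.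
From mathcomp Require Import all_boot all_order all_algebra.
From mathcomp Require Import all_classical all_reals all_analysis.
From mathcomp Require Import ring lra.

Set Implicit Arguments.
Unset Strict Implicit.
Unset Printing Implicit Defensive.

Import Order.TTheory GRing.Theory Num.Theory.
Import numFieldNormedType.Exports.

Local Open Scope classical_set_scope.
Local Open Scope ring_scope.

(** In a dendrite the arc [ab] is the set [seg a b] of points lying in every
    connected set containing [a] and [b]: a point of an arc that failed to
    separate its ends could be bypassed by a second arc, and the two would contain
    a simple closed curve. With this description, most order-theoretic facts about
    arcs are formal. The key dynamical fact is that [y] in the arc from [x] to
    [g y] forces a fixed point of [g] beyond [y] as seen from [x]; applied from
    both ends of an expanding arc to [f^n] or [f^2n], it produces two fixed points
    separated by a point that is not fixed. *)

(** * General topology *)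

(** The bypass of a point needs arcwise connectedness relative to an open set: two points of a
    connected set contained in an open [O] are joined by an arc in [O]. Neither paths nor arcs are
    given beforehand. Local connectedness only provides small connected sets, so paths are built as
    limits of chains, and a path must then lose its loops and its resting times to become an arc.
    The second iterate answers a question of orientation. Let [u] and [v] be points of an expanding
    arc [ab] sent to [a] and [b]. The fixed points found beyond [v] from [a] and beyond [u] from [b]
    enclose [u] and [v] when [u] precedes [v] seen from [a]. In the reverse order they may coincide:
    the truncation to [[-1, 1]] of [x -> -2x] expands a small interval around [0], but fixes only
    [0]. Its square restores the order. *)

Lemma connected_image (T U : topologicalType) (f : T -> U) (A : set T) :
  continuous f -> connected A -> connected (f @` A).
Proof.
move=> cf cA; apply: connected_continuous_connected => //.
exact: continuous_subspaceT.
Qed.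

Lemma compact_image (T U : topologicalType) (f : T -> U) (A : set T) :
  continuous f -> compact A -> compact (f @` A).
Proof.
move=> cf cA; apply: continuous_compact => //.
exact: continuous_subspaceT.
Qed.

(** The chain is a filter base, and a cluster point of it lies in every closed member. *)
Lemma compact_chain (T : topologicalType) (A : set T) (F : set (set T)) :
  compact A -> F !=set0 ->
  (forall B, F B -> [/\ closed B, B `<=` A & B !=set0]) ->
  total_on F subset -> exists p, forall B, F B -> B p.
Proof.
move=> cA [B0 FB0] FP tF.
have FF : ProperFilter (filter_from F id).
  apply: filter_from_proper; last by move=> B /FP[].
  apply: filter_from_filter; first by exists B0.
  move=> B C FB FC; case: (tF _ _ FB FC) => BC; [exists B|exists C] => //.
    by move=> z Bz; split => //; exact: BC.
  by move=> z Cz; split => //; exact: BC.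
have FA : filter_from F id A by exists B0 => //; have [] := FP _ FB0.
have [p [Ap clp]] := cA _ FF FA; exists p => B FB.
have [cB _ _] := FP _ FB; apply: cB => N Np.
by apply: clp => //; exists B.
Qed.

(** The inverse is continuous because the part of [A] outside an open set is compact, so its image
    is closed. *)
Lemma compact_homeomorphism_on (T U : topologicalType) (A : set T) (h : T -> U) :
  hausdorff_space U -> compact A -> A !=set0 -> {within A, continuous h} ->
  {in A &, injective h} -> exists k, homeomorphism_on A (h @` A) h k.
Proof.
move=> hU cA [x0 Ax0] ch ih.
have /choice[k Hk] : forall y : U, exists x, (h @` A) y -> A x /\ h x = y.
  move=> y; have [[x Ax hx]|] := pselect ((h @` A) y); last by exists x0.
  by exists x.
have kh x : A x -> k (h x) = x.
  move=> Ax; have [Akx hkx] := Hk (h x) (ex_intro2 _ _ x Ax erefl).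
  by apply: ih => //; exact: mem_set.
exists k; split => //; last first.
- by move=> x Ax; split; [exists x|exact: kh].
apply/subspace_continuousP => _ [x Ax <-] V.
rewrite /from_subspace kh// => Vx.
change (\forall y \near h x, (h @` A) y -> V (k y)).
pose B := A `&` ~` (interior V).
have cB : closed (h @` B).
  apply: compact_closed => //; apply: continuous_compact.
    by apply: continuous_subspaceW ch; exact: subIsetl.
  by apply: compact_closedI => //; apply: open_closedC; exact: open_interior.
have nBx : ~ (h @` B) (h x).
  move=> [x' [Ax' nVx'] /ih xx']; apply: nVx'.
  by rewrite xx' ?inE//; exact: Vx.
apply: filterS (open_nbhs_nbhs (conj (closed_openC cB) nBx)) => y /= nBy Ay.
have [Aky hky] := Hk _ Ay; apply: contrapT => nVk.
apply: nBy; exists (k y) => //; split => //.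
by move=> /interior_subset.
Qed.

Lemma iter_continuous (X : topologicalType) (f : X -> X) n :
  continuous f -> continuous (iter n f).
Proof.
move=> cf; elim: n => [|n IH] x //=.
exact: (continuous_comp (IH x) (cf _)).
Qed.

Lemma nbhs_mdist (R : realType) (X : metricType R) (x : X) (r : R) :
  0 < r -> \forall y \near x, mdist x y < r.
Proof.
move=> r0; have := @nbhsx_ballx _ _ x r r0.
by rewrite ballEmdist.
Qed.

Lemma nbhs_mdistP (R : realType) (X : metricType R) (x : X) (U : set X) :
  nbhs x U -> exists2 r, 0 < r & forall y, mdist x y < r -> U y.
Proof.
rewrite -nbhs_ballE => -[r /= r0 H]; exists r => // y xy.
by apply: H; rewrite ballEmdist.
Qed.

Lemma closed_mdist_le (R : realType) (X : metricType R) (x : X) (r : R) :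
  closed [set y | mdist x y <= r].
Proof.
rewrite -openC openE => y /= /negP; rewrite -ltNge => ry.
have : 0 < mdist x y - r by lra.
move=> /(nbhs_mdist y); apply: filterS => z yz /= xz.
have := metric_triangle x z y; rewrite (metric_sym z y); lra.
Qed.

Lemma open_mdist_lt (R : realType) (X : metricType R) (x : X) (r : R) :
  open [set y | mdist x y < r].
Proof.
rewrite openE => y /= xy.
have : 0 < r - mdist x y by lra.
move=> /(nbhs_mdist y); apply: filterS => z yz /=.
by have := metric_triangle x y z; lra.
Qed.

(** Agreement is required only where [phi] vanishes on [S]: for the circle and the ordinate, these
    are just two points. *)
Lemma continuous_paste (R : realType) (T U : topologicalType) (S : set T)
    (phi : T -> R) (f g : T -> U) :
  continuous phi -> continuous f -> continuous g ->
  (forall p, S p -> phi p = 0 -> f p = g p) ->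
  {within S, continuous (fun p => if phi p <= 0 then f p else g p)}.
Proof.
move=> cphi cf cg fg; apply/subspace_continuousP => x Sx V.
rewrite /from_subspace /= => Vx.
change (\forall p \near x, S p -> V (if phi p <= 0 then f p else g p)).
have [xneg|xpos|x0] := ltgtP (phi x) 0.
- have Vf : nbhs x (f @^-1` V).
    by apply: cf; move: Vx; rewrite (ltW xneg).
  have : \forall y \near x, phi y < 0 by exact: cvgr_lt (cphi x) _ xneg.
  move=> xn; near=> y => /=; move=> _.
  have Vy : V (f y) by near: y; exact: Vf.
  have yneg : phi y < 0 by near: y.
  by rewrite (ltW yneg).
- have Vf : nbhs x (g @^-1` V).
    by apply: cg; move: Vx; rewrite leNgt xpos.
  have : \forall y \near x, 0 < phi y by exact: cvgr_gt (cphi x) _ xpos.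
  move=> xn; near=> y => /=; move=> _.
  have Vy : V (g y) by near: y; exact: Vf.
  have ypos : 0 < phi y by near: y.
  by rewrite leNgt ypos.
- move: Vx; rewrite x0 lexx => Vx.
  have Vf : nbhs x (f @^-1` V) by exact: cf.
  have Vg : nbhs x (g @^-1` V) by apply: cg; rewrite -fg.
  by near=> y => /= _; case: ifP => _; near: y; [exact: Vf|exact: Vg].
Unshelve. all: by end_near. Qed.

(** Retraction of the line onto [[0, 1]]. Precomposing with it extends a path on the unit interval
    to a map continuous on all of [R]. *)
Definition clamp (R : realType) (t : R) : R := Num.max 0 (Num.min 1 t).

Lemma clampP (R : realType) (t : R) :
  [\/ t <= 0 /\ clamp t = 0, 0 <= t <= 1 /\ clamp t = t
    | 1 <= t /\ clamp t = 1].
Proof.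
rewrite /clamp; have [t0|t0] := leP t 0.
  by apply: Or31; split => //; rewrite min_r ?max_l//; lra.
have [t1|t1] := leP t 1.
  by apply: Or32; rewrite ltW// max_r// ltW.
by apply: Or33; rewrite max_r ?ltW//; lra.
Qed.

Lemma clamp_itv (R : realType) (t : R) : 0 <= clamp t <= 1.
Proof. by case: (clampP t) => -[? ->]; lra. Qed.

Lemma clamp_id (R : realType) (t : R) : 0 <= t <= 1 -> clamp t = t.
Proof. by case: (clampP t) => -[? ->]; lra. Qed.

Lemma clamp_contract (R : realType) (s t : R) :
  `|clamp s - clamp t| <= `|s - t|.
Proof.
have := ler_norm (s - t); have := lerNnormlW (lexx `|s - t|).
rewrite ler_norml.
by case: (clampP s) => -[? ->]; case: (clampP t) => -[? ->]; lra.
Qed.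

Lemma continuous_clamp_modulus (R : realType) (X : metricType R) (h : R -> X) :
  (forall e, 0 < e -> exists2 d, 0 < d &
     forall s t, 0 <= s -> s <= t -> t <= 1 -> t - s < d ->
     mdist (h s) (h t) < e) ->
  continuous (h \o @clamp R).
Proof.
move=> H t U /= /nbhs_mdistP[e e0 eU].
have [d d0 Hd] := H _ e0.
exists d => //= s /= st; apply: eU.
have /andP[? ?] := clamp_itv t; have /andP[? ?] := clamp_itv s.
have := clamp_contract t s; move: st; set a := clamp t; set b := clamp s.
move=> st; rewrite ler_norml => /andP[? ?].
case: (leP a b) => ab; first by apply: Hd => //; lra.
by rewrite metric_sym; apply: Hd => //; lra.
Qed.

(** * Paths in locally connected compact spaces *)

(** A connected neighbourhood of [x] of radius at most [e / 2] serves all centres close to [x];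
    compactness then makes [d] uniform. *)
Lemma uniformly_locally_connected (R : realType) (X : metricType R) (e : R)
    (cX : compact [set: X]) (lc : is_locally_connected X) : 0 < e ->
  exists2 d, 0 < d & forall x y : X, mdist x y < d -> exists C : set X,
    [/\ connected C, C x, C y & forall z, C z -> mdist x z < e].
Proof.
move=> e0.
pose P (d : R) (x : X) := forall y : X, mdist x y < d -> exists C : set X,
    [/\ connected C, C x, C y & forall z, C z -> mdist x z < e].
have /compact_near_coveringP/(_ R (0^'+) P _) := cX.
have H : forall x : X, [set: X] x -> \forall x' \near x & d \near 0^'+, P d x'.
  move=> x _.
  have e2 : 0 < e / 2 by lra.
  have [V [oV Vx cV Ve]] := lc _ _ (nbhs_mdist x e2).
  have [r r0 rV] := nbhs_mdistP (open_nbhs_nbhs (conj oV Vx)).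
  have r2 : 0 < r / 2 by lra.
  near=> x' d => y /= x'y; exists V.
  have xx' : mdist x x' < r / 2 by near: x'; exact: nbhs_mdist.
  have dr : d < r / 2 by near: d; exact: nbhs_right_lt.
  have Vx' : V x' by apply: rV; lra.
  split => //.
    by apply: rV; have := metric_triangle x x' y; lra.
  move=> z /Ve xz; have := metric_triangle x' x z; rewrite (metric_sym x' x).
  by have := Ve _ Vx'; lra.
move=> /(_ H) {}H.
near ((0 : R)^'+) => d; exists d; first by near: d; exact: nbhs_right_gt.
by move=> x; apply: (near H d).
Unshelve. all: by end_near. Qed.

(** The points reachable from [x] by [d]-chains in [C] form a relatively clopen subset of [C]. *)
Lemma connected_chain (R : realType) (X : metricType R) (C : set X) (x y : X)
    (d : R) : connected C -> C x -> C y -> 0 < d ->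
  exists q n, [/\ q 0%N = x, q n = y,
    forall i, (i < n)%N -> mdist (q i) (q i.+1) < d &
    forall i, (i <= n)%N -> C (q i)].
Proof.
move=> cC Cx Cy d0.
pose B := [set z | exists q n, [/\ q 0%N = x, q n = z,
    forall i, (i < n)%N -> mdist (q i) (q i.+1) < d &
    forall i, (i <= n)%N -> C (q i)]].
have BC : B `<=` C by move=> z [q [n [_ <- _]]]; apply.
have Bstep z w : B z -> C w -> mdist z w < d -> B w.
  move=> [q [n [q0 qn qd qC]]] Cw zw.
  exists (fun i => if (i <= n)%N then q i else w), n.+1; split => //.
  - by rewrite ltnn.
  - by move=> i; rewrite ltnS; case: (ltngtP i n) => // [/qd //|-> _]; rewrite qn.
  - by move=> i _; case: ifP => // /qC.
suff BE : B = C by have : B y by rewrite BE.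
apply: cC.
- exists x; exists (fun=> x), 0%N; split => //.
- exists (\bigcup_(z in B) [set w | mdist z w < d]).
    by apply: bigcup_open => z _; exact: open_mdist_lt.
  apply/seteqP; split => [z Bz|w [Cw [z Bz zw]]].
    split; first exact: BC.
    by exists z => //=; rewrite mdistxx.
  exact: (Bstep z).
- exists (~` (\bigcup_(z in C `\` B) [set w | mdist z w < d])).
    by apply: open_closedC; apply: bigcup_open => z _; exact: open_mdist_lt.
  apply/seteqP; split => [z Bz|w [Cw nw]].
    split; first exact: BC.
    move=> [w [Cw nBw]] /= wz; apply: nBw; apply: (Bstep z) => //.
    by rewrite metric_sym.
  apply: contrapT => nBw; apply: nw.
  by exists w => //=; rewrite mdistxx.
Qed.

(** Compactness of [X * X] bounds the lengths of the chains, and padding makes one length [N] serve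
    all pairs; this is what lets [refined_chain] index points by quotient and remainder. *)
Lemma uniform_chains (R : realType) (X : metricType R) (e : R)
    (cX : compact [set: X]) (lc : is_locally_connected X) : 0 < e ->
  exists d, [/\ 0 < d, d <= e & forall d', 0 < d' ->
    exists2 N, (0 < N)%N & forall x y : X, mdist x y < d -> exists p : nat -> X,
    [/\ p 0%N = x, p N = y,
        forall i, (i < N)%N -> mdist (p i) (p i.+1) < d' &
        forall i, mdist x (p i) < e]].
Proof.
move=> e0; have e2 : 0 < e / 2 by lra.
have [c c0 Hc] := uniformly_locally_connected cX lc e2.
have m0 : 0 < Num.min (c / 2) e by rewrite lt_min; apply/andP; split; lra.
have mc : Num.min (c / 2) e <= c / 2 by rewrite ge_min lexx.
exists (Num.min (c / 2) e); split => //; first by rewrite ge_min lexx orbT.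
set dd := Num.min _ _ in m0 mc *; move=> d d0.
pose P (N : nat) (xy : X * X) := mdist xy.1 xy.2 < dd -> exists p : nat -> X,
    [/\ p 0%N = xy.1, p N = xy.2,
        forall i, (i < N)%N -> mdist (p i) (p i.+1) < d &
        forall i, mdist xy.1 (p i) < e].
have cXX : compact [set: X * X] by rewrite -setXTT; exact: compact_setX.
have /compact_near_coveringP/(_ nat \oo P _) := cXX.
have H : forall xy : X * X, [set: X * X] xy ->
    \forall xy' \near xy & N \near \oo, P N xy'.
  move=> [x y] _.
  pose r := Num.min d (Num.min (c / 4) (e / 2)).
  have r0 : 0 < r by rewrite !lt_min; apply/and3P; split; lra.
  have [rd rc re] : [/\ r <= d, r <= c / 4 & r <= e / 2].
    by rewrite /r !ge_min !lexx ?orbT.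
  have nx : \forall xy' \near (x, y), mdist x xy'.1 < r /\ mdist y xy'.2 < r.
    exists ([set x' | mdist x x' < r], [set y' | mdist y y' < r]).
      by split; exact: nbhs_mdist.
    by move=> [x' y'] /= [].
  (* If [x] and [y] are at distance at least [c], no pair within [c / 4] of them is closer than
     [c / 2], so the claim is vacuous nearby. *)
  have [xy|xy] := ltP (mdist x y) c; last first.
    near=> xy' N; rewrite /P /=.
    have [xx' yy'] : mdist x xy'.1 < r /\ mdist y xy'.2 < r by near: xy'.
    move=> x'y'; exfalso.
    have := metric_triangle x xy'.1 y; have := metric_triangle xy'.1 xy'.2 y.
    rewrite (metric_sym xy'.2 y); lra.
  have [C [cC Cx Cy Ce]] := Hc _ _ xy.
  have [q [n [q0 qn qd qC]]] := connected_chain cC Cx Cy d0.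
  near=> xy' N; rewrite /P /=.
  have [xx' yy'] : mdist x xy'.1 < r /\ mdist y xy'.2 < r by near: xy'.
  have nN : (n.+2 <= N)%N by near: N; exact: nbhs_infty_ge.
  move=> x'y'.
  (* The chain from [x] to [y] gets the ends of the nearby pair attached to it, and the last one is
     repeated: any length from [n + 2] on is possible. *)
  exists (fun i => if i is j.+1 then (if (j <= n)%N then q j else xy'.2)
                   else xy'.1); split => //.
  - have EN : N = N.-1.+1 by rewrite prednK// (leq_trans _ nN).
    by move: nN; rewrite EN ltnS leqNgt => nN; rewrite ifN.
  - move=> [_|j jN]; first by rewrite leq0n q0 metric_sym; lra.
    case: (ltngtP j n) => jn.
    + exact: qd.
    + by rewrite mdistxx.
    + by rewrite jn qn; lra.
  - case => [|j]; first by rewrite mdistxx.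
    case: ifP => [/qC/Ce xq|_]; last first.
      by apply: lt_le_trans x'y' _; rewrite ge_min lexx orbT.
    by have := metric_triangle xy'.1 x (q j); rewrite (metric_sym xy'.1 x); lra.
move=> /(_ H) {}H.
near \oo => N; exists N; first by near: N; exact: nbhs_infty_gt.
by move=> x y; apply: (near H N _ (x, y)).
Unshelve. all: by end_near. Qed.

Lemma half_powers_small (R : realType) (e r : R) : 0 < r ->
  exists k : nat, e / 2 ^+ k < r.
Proof.
move=> r0; exists (Num.truncn (e / r)).
have [e0|e0] := ltP 0 e; last first.
  by apply: le_lt_trans r0; rewrite mulr_le0_ge0// invr_ge0 exprn_ge0.
rewrite ltr_pdivrMr ?exprn_gt0// mulrC -ltr_pdivrMr//.
have /andP[_ H] := truncn_itv (ltW (divr_gt0 e0 r0)).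
apply: lt_le_trans H _.
by rewrite -natrX ler_nat ltn_expl.
Qed.

(** Aligns the indices of two consecutive refinement levels at the same time. *)
Lemma divn_truncn (R : realType) (x : R) (n : nat) : (0 < n)%N -> 0 <= x ->
  (Num.truncn (x * n%:R) %/ n)%N = Num.truncn x.
Proof.
move=> n0 x0; apply/esym/eqP; rewrite truncn_eq//.
have n0' : 0 < n%:R :> R by rewrite ltr0n.
have xn0 : 0 <= x * n%:R by rewrite mulr_ge0// ltW.
have /andP[H1 H2] := truncn_itv xn0.
apply/andP; split.
  rewrite -(ler_pM2r n0') (le_trans _ H1)// -natrM ler_nat.
  exact: leq_trunc_div.
rewrite -(ltr_pM2r n0') (lt_le_trans H2)// -natrM ler_nat.
by rewrite ltn_ceil.
Qed.

(* Successive refinements of a two-point chain: level [k.+1] inserts [N k] steps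
   between consecutive points of level [k]. *)
Fixpoint refined_chain (X : Type) (p : nat -> X -> X -> nat -> X)
    (N : nat -> nat) (x y : X) (k i : nat) : X :=
  if k is j.+1 then
    p j (refined_chain p N x y j (i %/ N j))
        (refined_chain p N x y j (i %/ N j).+1) (i %% N j)%N
  else if i == 0%N then x else y.

Lemma small_paths (R : realType) (X : metricType R) (e : R)
    (cX : compact [set: X]) (lc : is_locally_connected X) : 0 < e ->
  exists2 d, 0 < d & forall x y : X, mdist x y < d -> exists h : R -> X,
    [/\ continuous h, h 0 = x, h 1 = y & forall t, mdist x (h t) < e].
Proof.
(* Level [k] moves points by less than [E k], hence all levels from [k] on by at most [2 * E k]. The
   factor [1 / 3] makes [2 * E 0] smaller than [e]. *)
move=> e0; pose E k : R := e / 3 / 2 ^+ k.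
have E0 k : 0 < E k by rewrite /E !divr_gt0// exprn_gt0.
have ES k : 2 * E k.+1 = E k.
  by rewrite /E exprS; field; rewrite expf_neq0.
have [d Hd] := choice (fun k => uniform_chains cX lc (E0 k)).
have d0 k : 0 < d k by have [] := Hd k.
have dE k : d k <= E k by have [] := Hd k.
have /choice[N HN] : forall k, exists N, (0 < N)%N /\
    forall x y : X, mdist x y < d k -> exists p : nat -> X,
    [/\ p 0%N = x, p N = y,
        forall i, (i < N)%N -> mdist (p i) (p i.+1) < d k.+1 &
        forall i, mdist x (p i) < E k].
  by move=> k; have [_ _ /(_ _ (d0 k.+1))[N N0 H]] := Hd k; exists N.
have N0 k : (0 < N k)%N by have [] := HN k.
have /choice[p Hp] : forall k, exists p : X -> X -> nat -> X,
    forall x y : X, mdist x y < d k ->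
    [/\ p x y 0%N = x, p x y (N k) = y,
        forall i, (i < N k)%N -> mdist (p x y i) (p x y i.+1) < d k.+1 &
        forall i, mdist x (p x y i) < E k].
  move=> k; have [_ H] := HN k.
  have /choice[p Hp] : forall xy : X * X, exists p : nat -> X,
      mdist xy.1 xy.2 < d k -> [/\ p 0%N = xy.1, p (N k) = xy.2,
        forall i, (i < N k)%N -> mdist (p i) (p i.+1) < d k.+1 &
        forall i, mdist xy.1 (p i) < E k].
    move=> [x y]; have [/H[p Hp]|nxy] := pselect (mdist x y < d k).
      by exists p.
    by exists (fun=> x).
  by exists (fun x y => p (x, y)) => x y /(Hp (x, y)).
exists (d 0%N) => // x y xy.
pose g := refined_chain p N x y.
have gd k i : mdist (g k i) (g k i.+1) < d k.
  elim: k i => [|k IH] i /=; first by case: i => //= i; rewrite mdistxx.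
  rewrite /g /= -/g.
  have [p0 pN pd _] := Hp k _ _ (IH (i %/ N k)%N).
  (* Either [i] is the last index of its block, and its successor opens the next block at the common
     endpoint, or both lie in one block. *)
  have := ltn_pmod i (N0 k); rewrite leq_eqVlt => /orP[/eqP iN|iN].
    have -> : (i.+1 %/ N k)%N = (i %/ N k).+1.
      by rewrite {1}(divn_eq i (N k)) -addnS iN divnDr// divnn N0 mulnK// addn1.
    have -> : (i.+1 %% N k)%N = 0%N.
      by rewrite {1}(divn_eq i (N k)) -addnS iN modnMDl modnn.
    have [-> _ _ _] := Hp k _ _ (IH (i %/ N k).+1).
    by have := pd _ (ltn_pmod i (N0 k)); rewrite iN pN.
  have -> : (i.+1 %/ N k)%N = (i %/ N k)%N.
    by rewrite {1}(divn_eq i (N k)) -addnS divnMDl// (divn_small iN) addn0.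
  have -> : (i.+1 %% N k)%N = (i %% N k).+1.
    by rewrite {1}(divn_eq i (N k)) -addnS modnMDl (modn_small iN).
  by apply: pd; exact: ltnW.
have gE k i : mdist (g k (i %/ N k)%N) (g k.+1 i) < E k.
  by have [_ _ _] := Hp k _ _ (gd k (i %/ N k)%N); apply.
pose M k := (\prod_(j < k) N j)%N.
have M0 k : (0 < M k)%N by rewrite /M prodn_gt0.
have MS k : M k.+1 = (M k * N k)%N by rewrite /M big_ord_recr.
have g0 k : g k 0%N = x.
  elim: k => [//|k IH]; rewrite /g /= -/g div0n mod0n.
  by have [-> _ _ _] := Hp k _ _ (gd k 0%N).
have gM k : g k (M k) = y.
  elim: k => [|k IH]; first by rewrite /M big_ord0.
  rewrite /g /= -/g MS mulnK// modnMl.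
  by have [-> _ _ _] := Hp k _ _ (gd k (M k)).
pose u k (t : R) := g k (Num.truncn (t * (M k)%:R)).
have uE k t : 0 <= t -> mdist (u k t) (u k.+1 t) < E k.
  move=> t0; have tM : 0 <= t * (M k)%:R by rewrite mulr_ge0.
  by rewrite /u -(divn_truncn (N0 k) tM) -mulrA -natrM -MS; exact: gE.
(* The limit at [t] is a common point of the closed balls of radius [2 * E k] about [u k t]; they
   are nested because [2 * E k.+1 = E k]. *)
have /choice[h hu] : forall t : R, exists c, 0 <= t ->
    forall k, mdist (u k t) c <= 2 * E k.
  move=> t; have [t0|] := pselect (0 <= t); last by exists x.
  pose B k := [set c | mdist (u k t) c <= 2 * E k].
  have BS k : B k.+1 `<=` B k.
    move=> c /=; rewrite /B/= ES; have := uE k t t0.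
    by have := metric_triangle (u k t) (u k.+1 t) c; lra.
  have Bmono j k : (j <= k)%N -> B k `<=` B j.
    move=> /subnK <-; elim: (k - j)%N => [//|n IH].
    by apply: subset_trans IH; exact: BS.
  have [|||c Hc] := @compact_chain X setT (range B) cX.
  - by exists (B 0%N), 0%N.
  - move=> _ [k _ <-]; split => //; first exact: closed_mdist_le.
    by exists (u k t); rewrite /B/= mdistxx mulr_ge0// ltW.
  - move=> _ _ [j _ <-] [k _ <-].
    by have [/Bmono|/ltnW/Bmono] := leqP j k; [right|left].
  by exists c => _ k; apply: (Hc (B k)); exists k.
have hE t c : 0 <= t -> (forall k, u k t = c) -> h t = c.
  move=> t0 uc; apply/esym/mdist_positivity/le_anti; rewrite mdist_ge0 andbT.
  apply/ler_addgt0Pr => r r0; rewrite add0r.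
  have [k kr] := half_powers_small (2 * (e / 3)) r0.
  have := hu t t0 k; rewrite uc => /le_trans; apply.
  by rewrite /E mulrA ltW.
have h0 : h 0 = x by apply: hE => // k; rewrite /u mul0r truncn0.
have h1 : h 1 = y by apply: hE => // k; rewrite /u mul1r natrK.
exists (h \o @clamp R); split.
- apply: continuous_clamp_modulus => r r0.
  (* Times closer than [1 / M k] have equal or consecutive indices, which costs [E k]; passing from
     [u k] to [h] costs [2 * E k] at each end. *)
  have [k kr] := half_powers_small (5 * (e / 3)) r0.
  exists (M k)%:R^-1; first by rewrite invr_gt0 ltr0n.
  move=> s t s0 st t1 ts.
  have t0 := le_trans s0 st.
  have us := hu s s0 k; have ut := hu t t0 k.
  suff : mdist (u k s) (u k t) < E k.
    have : r > 5 * E k by rewrite /E mulrA.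
    have := metric_triangle (h s) (u k s) (h t).
    have := metric_triangle (u k s) (u k t) (h t).
    by rewrite (metric_sym (h s) (u k s)); lra.
  have Mk0 : 0 < (M k)%:R :> R by rewrite ltr0n.
  have sM0 : 0 <= s * (M k)%:R by rewrite mulr_ge0.
  have tM0 : 0 <= t * (M k)%:R by rewrite mulr_ge0.
  rewrite /u; set i := Num.truncn (s * _); set j := Num.truncn (t * _).
  have ij : (i <= j)%N by apply: le_truncn; rewrite ler_pM2r.
  have ji : (j <= i.+1)%N.
    rewrite -ltnS truncn_lt_nat//.
    have /andP[_ H] := truncn_itv sM0.
    move: ts; rewrite -(ltr_pM2r Mk0) mulVf ?gt_eqF// mulrBl.
    rewrite -/i in H.
    rewrite -[i.+2]addn1 natrD; lra.
  have := gd k i; have := dE k.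
  move: ij ji; rewrite leq_eqVlt => /orP[/eqP <- _|ij ji].
    by rewrite mdistxx.
  have -> : j = i.+1 by apply/eqP; rewrite eqn_leq ji ij.
  lra.
- by rewrite /= clamp_id// lexx ler01.
- by rewrite /= clamp_id// lexx ler01.
- move=> t /=; have /andP[] := clamp_itv t; set s := clamp t => s0.
  (* The level 0 function is [x] on [[0, 1[] and jumps to [y] at 1. *)
  rewrite le_eqVlt => /orP[/eqP ->|s1].
    by rewrite h1; have := dE 0%N; rewrite /E expr0 divr1; lra.
  have := hu s s0 0%N.
  have -> : u 0%N s = x.
    by rewrite /u /M big_ord0 mulr1 (@truncn_def _ _ 0%N)// s0.
  by rewrite /E expr0 divr1; lra.
Qed.

Definition path_within (R : realType) (X : topologicalType) (U : set X)
    (x y : X) : Prop :=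
  exists h : R -> X, [/\ continuous h, h 0 = x, h 1 = y & forall t, U (h t)].

Lemma path_within_trans (R : realType) (X : topologicalType) (U : set X)
    (x y z : X) :
  path_within R U x y -> path_within R U y z -> path_within R U x z.
Proof.
move=> [f [cf f0 f1 fU]] [g [cg g0 g1 gU]].
exists (fun t => if t - 2^-1 <= 0 then f (clamp (2 * t)) else g (clamp (2 * t - 1))).
have cc : continuous (@clamp R).
  move=> t; apply/cvgrPdist_lt => e e0; exists e => //= s.
  by apply: le_lt_trans; exact: clamp_contract.
split.
- apply/continuous_subspace_setT.
  apply: (@continuous_paste R R X setT (fun t => t - 2^-1)
    (fun t => f (clamp (2 * t))) (fun t => g (clamp (2 * t - 1)))) => t.
  + by apply: cvgB => //; exact: cvg_cst.
  + have c2 : {for t, continuous (fun t : R => 2 * t)}.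
      by apply: cvgM => //; exact: cvg_cst.
    exact: (continuous_comp (continuous_comp c2 (cc _)) (cf _)).
  + have c2 : {for t, continuous (fun t : R => 2 * t - 1)}.
      by apply: cvgB; [apply: cvgM => //; exact: cvg_cst|exact: cvg_cst].
    exact: (continuous_comp (continuous_comp c2 (cc _)) (cg _)).
  + move=> _ t2; rewrite (_ : 2 * t = 1) ?subrr; last lra.
    by rewrite !clamp_id ?f1 ?g0// ?lexx ler01.
- by rewrite ifT; [rewrite mulr0 clamp_id ?lexx ?ler01|lra].
- rewrite ifF; last by apply/negbTE; rewrite -ltNge; lra.
  by rewrite clamp_id; [rewrite (_ : 2 * 1 - 1 = 1)//; lra|lra].
- by move=> t; case: ifP.
Qed.

(** Reachability by paths in [O] is a relatively clopen condition on [C], since small paths near a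
    point of [O] stay in [O]. The paths may leave [C]. *)
Lemma connected_path_within (R : realType) (X : metricType R) (O C : set X)
    (x y : X) (cX : compact [set: X]) (lc : is_locally_connected X) :
  open O -> connected C -> C `<=` O -> C x -> C y -> path_within R O x y.
Proof.
move=> oO cC CO Cx Cy.
have locp z : O z -> exists2 r, 0 < r & forall w, mdist z w < r ->
    path_within R O z w /\ path_within R O w z.
  move=> Oz; have [e e0 He] := nbhs_mdistP (open_nbhs_nbhs (conj oO Oz)).
  have e2 : 0 < e / 2 by lra.
  have [d d0 Hd] := small_paths cX lc e2.
  (* A path from [w] to [z] is only known to stay within [e / 2] of [w], so [w] must itself be
     within [e / 2] of [z]. *)
  exists (Num.min d (e / 2)); first by rewrite lt_min d0.
  move=> w; rewrite lt_min => /andP[zw zw2]; split.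
    have [h [ch h0 h1 hO]] := Hd _ _ zw; exists h; split => // t.
    by apply: He; have := hO t; lra.
  rewrite metric_sym in zw.
  have [h [ch h0 h1 hO]] := Hd _ _ zw; exists h; split => // t.
  by apply: He; have := hO t; have := metric_triangle z w (h t); lra.
pose B := [set z | C z /\ path_within R O x z].
suff BE : B = C by have [] : B y by rewrite BE.
apply: cC.
- exists x; split => //; exists (fun=> x); split => // [|_]; last exact: CO.
  by move=> ?; exact: cvg_cst.
- exists (interior [set z | path_within R O x z]); first exact: open_interior.
  apply/seteqP; split => [z [Cz xz]|z [Cz /interior_subset //]].
  split => //; have [r r0 Hr] := locp _ (CO _ Cz).
  apply: filterS (nbhs_mdist z r0) => w /Hr[zw _] /=.
  exact: path_within_trans xz zw.
- exists (~` interior [set z | ~ path_within R O x z]).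
    by apply: open_closedC; exact: open_interior.
  apply/seteqP; split => [z [Cz xz]|z [Cz nz]].
    by split => // /interior_subset.
  split => //; apply: contrapT => xz; apply: nz.
  have [r r0 Hr] := locp _ (CO _ Cz).
  apply: filterS (nbhs_mdist z r0) => w /Hr[_ wz] /= xw; apply: xz.
  exact: path_within_trans xw wz.
Qed.

(** * Extracting an arc from a path *)

Lemma closed_last (R : realType) (K : set R) (s b : R) :
  closed K -> K s -> s <= b ->
  exists m, [/\ K m, s <= m, m <= b & forall r, K r -> r <= b -> r <= m].
Proof.
move=> cK Ks sb; pose E := [set r | K r /\ r <= b].
have Es : E s by [].
have hE : has_sup E by split; [exists s|exists b => r []].
have EM : ubound E (sup E) by apply: ub_le_sup; exact: hE.2.
exists (sup E); split.
- apply: cK => U /nbhs_ballP[e e0 Ue].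
  have [r [Kr rb] er] := sup_adherent e0 hE.
  exists r; split => //; apply: Ue; rewrite /ball/= ger0_norm.
    by rewrite ltrBlDl -ltrBlDr.
  by rewrite subr_ge0; exact: EM.
- exact: EM.
- by apply: ge_sup; [exists s|move=> r []].
- by move=> r Kr rb; exact: EM.
Qed.

Lemma closed_first (R : realType) (K : set R) (s a : R) :
  closed K -> K s -> a <= s ->
  exists m, [/\ K m, m <= s, a <= m & forall r, K r -> a <= r -> m <= r].
Proof.
move=> cK Ks sa.
have cK' : closed (-%R @^-1` K : set R).
  by apply: preimage_closed => // x _; exact: opp_continuous.
have [m [Km sm mb mmax]] : exists m, [/\ (-%R @^-1` K : set R) m, - s <= m, m <= - a &
    forall r, (-%R @^-1` K : set R) r -> r <= - a -> r <= m].
  by apply: closed_last => //=; rewrite ?opprK ?lerN2.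
exists (- m); split => //; [lra|lra|].
by move=> r Kr ra; have := mmax (- r); rewrite /= opprK => /(_ Kr); lra.
Qed.

(** [U] is a set of discarded times: for open [U], [g] runs through a loop during each bounded
    component. *)
Definition loop_gaps (R : realType) (X : Type) (g : R -> X) (U : set R) : Prop :=
  forall s t, s < t -> ~ U s -> ~ U t -> (forall r, s < r -> r < t -> U r) ->
  g s = g t.

(** Let []s, t[] be a gap of the union. By compactness one member of the chain already contains
    [[s + d, t - d]]; the ends of its gap are within [d] of [s] and [t] and have equal values, and
    continuity of [g] gives [g s = g t]. *)
Lemma loop_gaps_bigcup (R : realType) (X : metricType R) (g : R -> X)
    (F : set (set R)) :
  continuous g -> (forall U, F U -> open U) -> (forall U, F U -> loop_gaps g U) ->
  total_on F subset -> loop_gaps g (\bigcup_(U in F) U).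
Proof.
move=> cg oF lF tF s t st Fs Ft H.
apply: mdist_positivity; apply/le_anti; rewrite mdist_ge0 andbT.
apply/ler_addgt0Pr => e e0; rewrite add0r.
have e2 : 0 < e / 2 by lra.
have := cg s _ (nbhs_mdist (g s) e2) => /nbhs_ballP[d1 /= d10 H1].
have := cg t _ (nbhs_mdist (g t) e2) => /nbhs_ballP[d2 /= d20 H2].
pose d := Num.min (Num.min (d1 / 2) (d2 / 2)) ((t - s) / 3).
have d0 : 0 < d by rewrite !lt_min; apply/andP; split; [apply/andP; split|]; lra.
have [dd1 dd2 dts] : [/\ d <= d1 / 2, d <= d2 / 2 & d <= (t - s) / 3].
  by rewrite /d !ge_min !lexx ?orbT.
have [U FU HU] : exists2 U, F U & `[s + d, t - d]%classic `<=` U.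
  (* Otherwise the sets of points missed by each member have a common point, which lies in no member
     although the union covers []s, t[]. *)
  apply: contrapT => nU.
  have [|||p Hp] := @compact_chain R `[s + d, t - d]%classic
      [set (`[s + d, t - d]%classic `\` U) | U in F] (@segment_compact _ _ _).
  - have [||U FU _] := H ((s + t) / 2); [lra|lra|].
    by exists (`[s + d, t - d]%classic `\` U), U.
  - move=> _ [U FU <-]; split.
    + rewrite setDE; apply: closedI; first exact: interval_closed.
      by apply: open_closedC; exact: oF.
    + by move=> x [].
    + apply/set0P/eqP => sU.
      by apply: nU; exists U => //; rewrite -setD_eq0.
  - move=> _ _ [U FU <-] [V FV <-].
    by case: (tF _ _ FU FV) => UV; [right|left]; exact: setDS.
  have [||V FV _] := H ((s + t) / 2); [lra|lra|].
  have [ps _] := Hp _ (ex_intro2 _ _ V FV erefl).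
  move: ps; rewrite /= in_itv/= => /andP[sp pt].
  have [||U FU Up] := H p; [lra|lra|].
  by have [_] := Hp _ (ex_intro2 _ _ U FU erefl); apply.
have cU : closed (~` U) by apply: open_closedC; exact: oF.
have nUs : ~ U s by move=> Us; apply: Fs; exists U.
have nUt : ~ U t by move=> Ut; apply: Ft; exists U.
have [s' [Ks' ss' s'd s'max]] := closed_last (s := s) (b := s + d) cU nUs ltac:(lra).
have [t' [Kt' tt' t'd t'min]] := closed_first (s := t) (a := t - d) cU nUt ltac:(lra).
have gst : g s' = g t'.
  apply: (lF U) => //; first lra.
  move=> r rs rt; apply: contrapT => nUr.
  have [rsd|rsd] := leP r (s + d); first by have := s'max _ nUr rsd; lra.
  have [rtd|rtd] := leP (t - d) r; first by have := t'min _ nUr rtd; lra.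
  by apply: nUr; apply: HU; rewrite /= in_itv/=; lra.
have /= := H1 s' ltac:(rewrite /ball/= ltr_norml; lra).
have /= := H2 t' ltac:(rewrite /ball/= ltr_norml; lra).
rewrite -gst (metric_sym (g t)).
by have := metric_triangle (g s) (g s') (g t); lra.
Qed.

(** [K] is the complement of a maximal open set of discarded times. When [g s = g t] with [s] and
    [t] retained, []s, t[] can be discarded as well, so by maximality no time in it was retained. *)
Lemma minimal_loop_gaps (R : realType) (X : metricType R) (g : R -> X) :
  continuous g -> exists K : set R, [/\ closed K, K 0, K 1, loop_gaps g (~` K) &
    forall s t r, 0 <= s -> t <= 1 -> K s -> K t -> g s = g t ->
      s < r -> r < t -> ~ K r].
Proof.
move=> cg.
pose P := [set U : set R | [/\ open U, ~ U 0, ~ U 1 & loop_gaps g U]].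
have [F FP tF|U [[oU U0 U1 lU] maxU]] := @Zorn_bigcup R P.
  split.
  - by apply: bigcup_open => U /FP[].
  - by move=> [U /FP[]].
  - by move=> [U /FP[]].
  - by apply: loop_gaps_bigcup => // U /FP[].
exists (~` U); split => //; [exact: open_closedC|by rewrite setCK|].
move=> s t r s0 t1 Us Ut gst sr rt Ur.
apply: (maxU (U `|` `]s, t[%classic)).
  split; first exact: subsetUl.
  by move=> /(_ r) H; apply: Ur; apply: H; right; rewrite /= in_itv/= sr rt.
have in_st x : ~ (U `|` `]s, t[%classic) x -> ~ U x /\ (x <= s \/ t <= x).
  move=> /not_orP[nUx]; rewrite /= in_itv/= => /negP.
  by rewrite negb_and -!leNgt => /orP H.
split.
- by apply: openU => //; exact: interval_open.
- by case => //; rewrite /= in_itv/=; lra.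
- by case => //; rewrite /= in_itv/=; lra.
- move=> x y xy /in_st[nUx xst] /in_st[nUy yst] Hxy.
  have Hin z : ~ U z -> z <= s \/ t <= z -> x < z -> z < y -> False.
    move=> nUz zst xz zy; case: (Hxy z xz zy) => //=.
    by rewrite in_itv/= => /andP[? ?]; case: zst; lra.
  (* A gap []x, y[] of the enlarged set lies to the left of [s] or to the right of [t], or else it
     is []s, t[] itself. *)
  case: (leP y s) => ys.
    apply: lU => // z xz zy; case: (Hxy z xz zy) => //=.
    by rewrite in_itv/=; lra.
  case: (leP t x) => tx.
    apply: lU => // z xz zy; case: (Hxy z xz zy) => //=.
    by rewrite in_itv/=; lra.
  have ty : t <= y by case: yst => //; lra.
  have xs : x <= s by case: xst => //; lra.
  have -> : x = s.
    apply/eqP; rewrite eq_le xs/= leNgt; apply/negP => xs'.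
    by apply: (Hin s) => //; left.
  have -> // : y = t.
    apply/eqP; rewrite eq_le ty andbT leNgt; apply/negP => ty'.
    by apply: (Hin t) => //; right.
Qed.

(* Cutting out the loops of [g]: on each gap of a minimal closed set [K] of
   retained times the new path rests at the common value of [g] at its ends. *)
Lemma monotone_path (R : realType) (X : metricType R) (g : R -> X) :
  continuous g -> exists f : R -> X,
  [/\ f 0 = g 0, f 1 = g 1, forall u, 0 <= u <= 1 -> exists w, f u = g w,
    forall u v, 0 <= u -> u <= v -> v <= 1 -> f u <> f v -> exists w w',
      [/\ u <= w <= v, u <= w' <= v, f u = g w & f v = g w'] &
    forall u r v, 0 <= u -> u <= r -> r <= v -> v <= 1 -> f u = f v ->
      f r = f u].
Proof.
move=> cg; have [K [cK K0 K1 lK mK]] := minimal_loop_gaps cg.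
(* [sg u] is the last retained time up to [u]. *)
have /choice[sg Hsg] : forall u : R, exists m, 0 <= u ->
    [/\ K m, 0 <= m, m <= u & forall r, K r -> r <= u -> r <= m].
  move=> u; have [u0|] := pselect (0 <= u); last by exists 0.
  by have [m Hm] := closed_last cK K0 u0; exists m.
have sgK u : 0 <= u -> K u -> sg u = u.
  move=> u0 Ku; have [_ _ su smax] := Hsg u u0.
  by apply/le_anti; rewrite su smax.
exists (g \o sg); split => /=.
- by rewrite sgK.
- by rewrite sgK// ler01.
- by move=> u _; exists (sg u).
- move=> u v u0 uv v1 fuv; have v0 := le_trans u0 uv.
  have [Ksu su0 suu sumax] := Hsg u u0; have [Ksv sv0 svv svmax] := Hsg v v0.
  have usv : u < sg v.
    rewrite ltNge; apply/negP => svu; apply: fuv; congr g.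
    by apply/le_anti; rewrite (svmax _ Ksu (le_trans suu uv)) (sumax _ Ksv svu).
  (* If [u] is discarded, []sg u, w[] is its gap, so [g (sg u) = g w]. Both values of [f] are thus
     taken by [g] during [[u, v]], which passes the modulus of continuity of [g] to [f]. *)
  have [w [Kw wv uw wmin]] := closed_first cK Ksv (ltW usv).
  exists w, (sg v); split => //; [by rewrite uw (le_trans wv)|by rewrite ltW|].
  have [Ku|nKu] := pselect (K u).
    by rewrite sgK//; congr g; apply/le_anti; rewrite uw wmin.
  have suw : sg u < w.
    rewrite lt_neqAle (le_trans suu uw) andbT; apply/eqP => suw.
    apply: nKu; rewrite (_ : u = w)//; apply/le_anti.
    by rewrite uw -suw suu.
  apply: lK => //=.
  move=> r ur rw /= Kr; have [ru|ru] := leP r u.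
    by have := sumax _ Kr ru; lra.
  by have := wmin _ Kr (ltW ru); lra.
- move=> u r v u0 ur rv v1 fuv.
  have r0 := le_trans u0 ur; have v0 := le_trans r0 rv.
  have [Ksu su0 suu sumax] := Hsg u u0; have [Ksv sv0 svv svmax] := Hsg v v0.
  have [Ksr sr0 srr srmax] := Hsg r r0.
  have sur : sg u <= sg r by apply: srmax => //; lra.
  have srv : sg r <= sg v by apply: svmax => //; lra.
  move: sur; rewrite le_eqVlt => /orP[/eqP <- //|sur].
  move: srv; rewrite le_eqVlt => /orP[/eqP -> //|srv].
  exfalso; apply: (mK (sg u) (sg v) (sg r)) => //; lra.
Qed.

Lemma half_powers_sum (R : realType) (n : nat) :
  \sum_(i < n) 2^-1 ^+ i.+1 = 1 - 2^-1 ^+ n :> R.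
Proof.
elim: n => [|n IH]; first by rewrite big_ord0 expr0 subrr.
by rewrite big_ord_recr/= IH exprS; field.
Qed.

(** [tau] is the sum of the [b n] with weights [2^-(n+1)]. Partial sums of the weights are below 1,
    so a common lower bound [c] on the increments survives in each partial sum as long as
    [c <= 0]. *)
Lemma weighted_sum (R : realType) (b : nat -> R -> R) :
  (forall n t, 0 <= b n t <= 1) -> exists tau : R -> R,
  (forall c s t, c <= 0 -> (forall n, c <= b n t - b n s) ->
     c <= tau t - tau s) /\
  (forall m s t, (forall n, b n s <= b n t) -> b m s < b m t -> tau s < tau t).
Proof.
move=> b01.
have w0 i : 0 < 2^-1 ^+ i.+1 :> R by rewrite exprn_gt0// invr_gt0.
pose S t n : R := \sum_(i < n) 2^-1 ^+ i.+1 * b i t.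
have SB s t n : S t n - S s n = \sum_(i < n) 2^-1 ^+ i.+1 * (b i t - b i s).
  by rewrite /S -sumrB; apply: eq_bigr => i _; rewrite mulrBr.
have cS t : cvgn (S t).
  apply: nondecreasing_is_cvgn.
    apply/nondecreasing_seqP => n; rewrite /S big_ord_recr/= lerDl.
    by apply: mulr_ge0; [exact: ltW|have /andP[] := b01 n t].
  exists 1 => _ [n _ <-].
  apply: (@le_trans _ _ (\sum_(i < n) 2^-1 ^+ i.+1)).
    apply: ler_sum => i _; apply: ler_piMr; first exact: ltW.
    by have /andP[] := b01 i t.
  by rewrite half_powers_sum lerBlDr lerDl exprn_ge0// invr_ge0.
pose tau t := limn (S t).
have lim_ge s t c : (\forall n \near \oo, c <= S t n - S s n) -> c <= tau t - tau s.
  move=> H.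
  have cTS : (S t n - S s n) @[n --> \oo] --> tau t - tau s.
    by apply: cvgB; exact: cS.
  rewrite -(cvg_lim _ cTS)//; apply: limr_ge => //.
  by apply/cvg_ex; exists (tau t - tau s).
exists tau; split.
- move=> c s t c0 H; apply: lim_ge; near=> n.
  rewrite SB; apply: (@le_trans _ _ (\sum_(i < n) 2^-1 ^+ i.+1 * c)).
    rewrite -mulr_suml half_powers_sum.
    have : 0 <= 2^-1 ^+ n :> R by rewrite exprn_ge0// invr_ge0.
    by nra.
  by apply: ler_sum => i _; rewrite ler_pM2l.
- move=> m s t H Hm; rewrite -subr_gt0.
  apply: (@lt_le_trans _ _ (2^-1 ^+ m.+1 * (b m t - b m s))).
    by rewrite mulr_gt0// subr_gt0.
  apply: lim_ge; near=> n.
  have mn : (m < n)%N by near: n; exact: nbhs_infty_gt.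
  rewrite SB (bigD1 (Ordinal mn))//= lerDl; apply: sumr_ge0 => i _.
  by rewrite mulr_ge0 ?subr_ge0// ltW.
Unshelve. all: by end_near. Qed.

(* The clock is the weighted sum of [1 - dist (x_n, f @` [0, t])], with the
   distance truncated at 1 and [x_n] dense in the image of [f]: it advances
   exactly when [f] reaches a new point. *)
Lemma monotone_path_clock (R : realType) (X : metricType R) (f : R -> X) :
  continuous f ->
  (forall u r v, 0 <= u -> u <= r -> r <= v -> v <= 1 -> f u = f v ->
      f r = f u) ->
  exists tau : R -> R,
  (forall a b w, 0 <= a -> a <= b -> b <= 1 -> 0 <= w ->
    (forall u, a <= u <= b -> mdist (f u) (f a) <= w) ->
    0 <= tau b - tau a <= w) /\
  (forall a b, 0 <= a -> a <= b -> b <= 1 -> f a <> f b -> tau a < tau b).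
Proof.
move=> cf ff.
(* The dense sequence consists of the values of [f] at rational times; undecodable codes fall back
   to time 0. *)
pose q n : R := if unpickle n is Some r then ratr r else 0.
pose phi n u : R := Num.min 1 (mdist (f u) (f (q n))).
have phi01 n u : 0 <= phi n u <= 1.
  by rewrite /phi le_min ler01 mdist_ge0/= ge_min lexx.
pose I n t := [set phi n u | u in `[0, clamp t]%classic].
have clamp0 t : 0 <= clamp t :> R by have /andP[] := clamp_itv t.
have I0 n t : I n t !=set0.
  by exists (phi n 0), 0 => //=; rewrite in_itv/= lexx clamp0.
have Ilb n t : has_lbound (I n t).
  by exists 0 => _ [u _ <-]; have /andP[] := phi01 n u.
pose F n t := inf (I n t).
have F_le n t u : 0 <= t <= 1 -> 0 <= u <= t -> F n t <= phi n u.
  move=> t01 ut; apply: (ge_inf (Ilb n t)); exists u => //=.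
  by rewrite in_itv/= clamp_id.
have F_ge n t c : 0 <= t <= 1 -> (forall u, 0 <= u <= t -> c <= phi n u) ->
    c <= F n t.
  move=> t01 H; apply: lb_le_inf => // _ [u + <-].
  by rewrite /= in_itv/= clamp_id//; exact: H.
have b01 n t : 0 <= 1 - F n t <= 1.
  have : F n t <= 1.
    apply: (@le_trans _ _ (phi n 0)); last by have /andP[] := phi01 n 0.
    apply: (ge_inf (Ilb n t)); exists 0 => //=.
    by rewrite in_itv/= lexx clamp0.
  have : 0 <= F n t.
    by apply: lb_le_inf => // _ [u _ <-]; have /andP[] := phi01 n u.
  lra.
have Fmono n a b : 0 <= a -> a <= b -> b <= 1 -> F n b <= F n a.
  move=> a0 ab b1; apply: F_ge => [|u ua]; first lra.
  by apply: F_le; lra.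
have [tau [tau1 tau2]] := weighted_sum b01.
exists tau; split.
- move=> a b w a0 ab b1 w0 H; apply/andP; split.
    by apply: tau1 => // n; have := Fmono n _ _ a0 ab b1; lra.
  (* The points reached during [[a, b]] are within [w] of [f a], so no infimum of distances drops by
     more than [w]. *)
  have : - w <= tau a - tau b; last by lra.
  apply: tau1 => [|n]; first lra.
  suff : F n a - w <= F n b by lra.
  apply: F_ge => [|u ub]; first lra.
  have [ua|au] := leP u a.
    by have := F_le n a u ltac:(lra) ltac:(lra); lra.
  have := F_le n a a ltac:(lra) ltac:(lra).
  suff : phi n a - w <= phi n u by lra.
  have := H u ltac:(lra); rewrite /phi (metric_sym (f u)) => au'.
  have := metric_triangle (f a) (f u) (f (q n)) => tr.
  rewrite le_min; apply/andP; split; rewrite lerBlDr ge_min; apply/orP.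
    by left; lra.
  by right; lra.
- move=> a b a0 ab b1 fab.
  have cI : closed (f @` `[0, a]).
    apply: compact_closed; first exact: metric_hausdorff.
    by apply: compact_image => //; exact: segment_compact.
  (* A visit to [f b] before time [a] would force [f a = f b]. *)
  have nfb : ~ (f @` `[0, a]) (f b).
    move=> [u /=]; rewrite in_itv/= => /andP[u0 ua] fub.
    by apply: fab; rewrite (ff u a b).
  have [r r0 Hr] := nbhs_mdistP (open_nbhs_nbhs (conj (closed_openC cI) nfb)).
  pose r1 := Num.min 1 r.
  have r10 : 0 < r1 by rewrite lt_min ltr01.
  have [r11 r1r] : r1 <= 1 /\ r1 <= r by rewrite /r1 !ge_min !lexx orbT.
  have r13 : 0 < r1 / 3 by lra.
  have /nbhs_ballP[d /= d0 Hd] := cf b _ (nbhs_mdist (f b) r13).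
  have [x] := @rat_in_itvoo R (b - d) (b + d) ltac:(lra).
  rewrite in_itv/= => xbd.
  have qx : q (pickle x) = ratr x by rewrite /q pickleK.
  apply: (tau2 (pickle x)) => [n|].
    by have := Fmono n _ _ a0 ab b1; lra.
  have /= Hx := Hd (ratr x) ltac:(rewrite /ball/= ltr_norml; lra).
  have : F (pickle x) b <= r1 / 3.
    apply: le_trans (F_le _ b b ltac:(lra) ltac:(lra)) _.
    by rewrite /phi qx ge_min (ltW Hx) orbT.
  suff : 2 * r1 / 3 <= F (pickle x) a by lra.
  apply: F_ge => [|u ua]; first lra.
  rewrite /phi qx le_min; apply/andP; split; first lra.
  have : ~ mdist (f b) (f u) < r.
    by move=> /Hr; apply; exists u => //=; rewrite in_itv/=.
  move=> /negP; rewrite -leNgt => ru.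
  have := metric_triangle (f b) (f (ratr x)) (f u).
  by rewrite (metric_sym (f u)); lra.
Qed.

(** On [[0, 1]] the clock [tau] identifies two times exactly when [f] does. [T] selects some time
    for each clock value; it may jump, but only between times at which [f] agrees, so [f \o T] is
    continuous and injective. *)
Lemma arc_of_monotone_path (R : realType) (X : metricType R) (f : R -> X) :
  continuous f -> f 0 <> f 1 ->
  (forall u r v, 0 <= u -> u <= r -> r <= v -> v <= 1 -> f u = f v ->
      f r = f u) ->
  exists h : R -> X, [/\ continuous h, h 0 = f 0, h 1 = f 1,
    {in `[0 : R, 1] &, injective h} &
    forall t, exists2 u, 0 <= u <= 1 & h t = f u].
Proof.
move=> cf f01 ff; have [tau [tauc taus]] := monotone_path_clock cf ff.
have tauE a b : 0 <= a <= 1 -> 0 <= b <= 1 -> f a = f b -> tau a = tau b.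
  wlog ab : a b / a <= b.
    move=> H a01 b01 fab; have [ab|/ltW ba] := leP a b; first exact: H.
    by apply/esym; apply: H.
  move=> a01 b01 fab; have := tauc a b 0 ltac:(lra) ab ltac:(lra) (lexx _).
  have H u : a <= u <= b -> mdist (f u) (f a) <= 0.
    by move=> aub; rewrite (ff a u b) ?mdistxx//; lra.
  by move=> /(_ H); lra.
have tauI a b : 0 <= a <= 1 -> 0 <= b <= 1 -> tau a = tau b -> f a = f b.
  wlog ab : a b / a <= b.
    move=> H a01 b01 fab; have [ab|/ltW ba] := leP a b; first exact: H.
    by apply/esym; apply: H.
  move=> a01 b01 tab; apply: contrapT => fab.
  by have := taus a b ltac:(lra) ab ltac:(lra) fab; lra.
have ctau : continuous (tau \o @clamp R).
  move=> t; apply/cvgrPdist_le => e e0 /=; set c := clamp t.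
  have e2 : 0 < e / 2 by lra.
  have /nbhs_ballP[d /= d0 Hd] := cf c _ (nbhs_mdist (f c) e2).
  exists d => //= s st.
  have := clamp_contract t s; rewrite -/c; set c' := clamp s => cc.
  have c01 : 0 <= c <= 1 := clamp_itv t.
  have c'01 : 0 <= c' <= 1 := clamp_itv s.
  have {}cc : `|c - c'| < d by apply: le_lt_trans st.
  move: cc; rewrite ltr_norml => cc.
  have Hu u : c <= u <= c' \/ c' <= u <= c -> mdist (f c) (f u) < e / 2.
    move=> ucc; have /= := Hd u; apply; rewrite /ball/= ltr_norml.
    by case: ucc; lra.
  rewrite ler_norml; have [ab|/ltW ba] := leP c c'.
    have := tauc c c' e ltac:(lra) ab ltac:(lra) (ltW e0).
    have H u : c <= u <= c' -> mdist (f u) (f c) <= e.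
      by move=> /(or_introl)/Hu; rewrite metric_sym; lra.
    by move=> /(_ H); lra.
  have := tauc c' c e ltac:(lra) ba ltac:(lra) (ltW e0).
  have H u : c' <= u <= c -> mdist (f u) (f c') <= e.
    move=> /(or_intror)/Hu; have := Hu c' (or_intror _).
    rewrite lexx ba => /(_ isT).
    by have := metric_triangle (f u) (f c) (f c'); rewrite (metric_sym (f u) (f c)); lra.
  by move=> /(_ H); lra.
have c0 : clamp 0 = 0 :> R by rewrite clamp_id// lexx ler01.
have c1 : clamp 1 = 1 :> R by rewrite clamp_id// lexx ler01.
have L0 : tau 0 < tau 1 by apply: taus; rewrite ?lexx ?ler01.
pose y t := tau 0 + clamp t * (tau 1 - tau 0).
have yE t : exists u, 0 <= u <= 1 /\ tau u = y t.
  have /andP[t0 t1] := clamp_itv t.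
  have [||u] := @IVT R (tau \o @clamp R) 0 1 (y t) ler01.
  - exact: continuous_subspaceT.
  - rewrite /= c0 c1 min_l ?max_r ?(ltW L0)// /y.
    by apply/andP; split; nra.
  - rewrite in_itv/= => u01; rewrite clamp_id// => ?; by exists u.
have /choice[T HT] := yE.
have T01 t : 0 <= T t <= 1 by have [] := HT t.
have TE t : tau (T t) = y t by have [] := HT t.
exists (f \o T); split => /=.
- move=> t U /= Uft.
  have [V [oV Vt VU]] : exists V, [/\ open V, V (f (T t)) & V `<=` U].
    by exists (interior U); split; [exact: open_interior|exact: Uft|exact: interior_subset].
  (* Continuity of [f \o T] without continuity of [T]: the times at which [f] is outside [V] form a
     compact set, whose clock values form a closed set missing [y t]. *)
  pose Z := `[0, 1]%classic `&` f @^-1` (~` V).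
  have cZ : compact Z.
    apply: compact_closedI; first exact: segment_compact.
    by apply: preimage_closed => //; exact: open_closedC.
  pose W := (tau \o @clamp R) @` Z.
  have cW : closed W.
    by apply: compact_closed; [exact: Rhausdorff|exact: compact_image].
  have nWy : ~ W (y t).
    move=> [u [/=]]; rewrite in_itv/= => u01; rewrite clamp_id// => nVu tu.
    by apply: nVu; rewrite (tauI u (T t))// TE.
  have cy : continuous y.
    move=> s; apply: cvgD; first exact: cvg_cst.
    apply: cvgM; last exact: cvg_cst.
    apply/cvgrPdist_lt => e e0; exists e => //= r.
    by apply: le_lt_trans; exact: clamp_contract.
  change (\forall s \near t, U (f (T s))).
  have : \forall s \near t, ~ W (y s).
    exact: (cy t _ (open_nbhs_nbhs (conj (closed_openC cW) nWy))).
  apply: filterS => s /= nWs; apply: VU; apply: contrapT => nV.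
  apply: nWs; exists (T s); last by rewrite /= clamp_id.
  by split => //=; rewrite in_itv/=.
- by apply: tauI; rewrite ?lexx ?ler01// TE /y c0; lra.
- by apply: tauI; rewrite ?lexx ?ler01// TE /y c1; lra.
- move=> s t; rewrite !in_itv/= => s01 t01 /tauE => /(_ (T01 s) (T01 t)).
  rewrite !TE /y !clamp_id// => /addrI/mulIf; apply.
  by rewrite subr_eq0 gt_eqF.
- by move=> t; exists (T t).
Qed.

Lemma path_within_arc (R : realType) (X : metricType R) (U : set X) (a b : X) :
  a <> b -> path_within R U a b ->
  exists h : R -> X, [/\ continuous h, h 0 = a, h 1 = b,
    {in `[0 : R, 1] &, injective h} & forall t, U (h t)].
Proof.
move=> ab [g [cg g0 g1 gU]].
have [f [f0 f1 fg fm ff]] := monotone_path cg.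
have c0 : clamp 0 = 0 :> R by rewrite clamp_id// lexx ler01.
have c1 : clamp 1 = 1 :> R by rewrite clamp_id// lexx ler01.
have cfc : continuous (f \o @clamp R).
  move=> t V /= /nbhs_mdistP[e e0 eV]; set c := clamp t in eV.
  have e2 : 0 < e / 2 by lra.
  have /nbhs_ballP[d /= d0 Hd] := cg c _ (nbhs_mdist (g c) e2).
  exists d => //= s st; apply: eV.
  have := clamp_contract t s; rewrite -/c; set c' := clamp s => cc.
  have c01 : 0 <= c <= 1 := clamp_itv t.
  have c'01 : 0 <= c' <= 1 := clamp_itv s.
  have {}cc : `|c - c'| < d by apply: le_lt_trans st.
  move: cc; rewrite ltr_norml => cc.
  have Hw w w' : `|c - w| < d -> `|c - w'| < d -> mdist (g w) (g w') < e.
    move=> /Hd /= H /Hd /= H'.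
    by have := metric_triangle (g w) (g c) (g w'); rewrite (metric_sym (g w) (g c)); lra.
  change (mdist (f c) (f c') < e).
  have [->|fcc] := pselect (f c = f c'); first by rewrite mdistxx.
  have [cc'|/ltW c'c] := leP c c'.
    have [w [w' [cw cw' -> ->]]] := fm c c' ltac:(lra) cc' ltac:(lra) fcc.
    by apply: Hw; rewrite ltr_norml; lra.
  have [w [w' [cw cw' Ew Ew']]] := fm c' c ltac:(lra) c'c ltac:(lra) (nesym fcc).
  by rewrite Ew Ew'; apply: Hw; rewrite ltr_norml; lra.
have [||h [ch h0 h1 ih hf]] := arc_of_monotone_path cfc.
- by rewrite /= c0 c1 f0 f1 g0 g1.
- move=> u r v u0 ur rv v1 /=; rewrite !clamp_id; [exact: ff|lra|lra|lra].
exists h; split => //.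
- by rewrite h0 /= c0 f0.
- by rewrite h1 /= c1 f1.
- move=> t; have [u u01 ->] := hf t; rewrite /= clamp_id//.
  by have [w ->] := fg _ u01.
Qed.

(** * Arcs in dendrites *)

Definition seg (X : topologicalType) (a b : X) : set X :=
  [set z | forall C : set X, connected C -> C a -> C b -> C z].

Definition parametrizes (R : realType) (X : topologicalType) (h : R -> X)
    (a b : X) (A : set X) : Prop :=
  [/\ continuous h, h 0 = a, h 1 = b,
      {in `[0 : R, 1] &, injective h} & A = h @` `[0, 1]].

(** What the dynamical lemmas use of a dendrite, apart from compactness, local connectedness and the
    Hausdorff property. *)
Definition segs_are_arcs (R : realType) (X : topologicalType) : Prop :=
  forall a b : X, a <> b -> exists h : R -> X, parametrizes h a b (seg a b).

Lemma segC (X : topologicalType) (a b : X) : seg a b = seg b a.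
Proof. by apply/seteqP; split => z H C cC Ca Cb; apply: H. Qed.

Lemma seg_left (X : topologicalType) (a b : X) : seg a b a.
Proof. by []. Qed.

Lemma seg_right (X : topologicalType) (a b : X) : seg a b b.
Proof. by []. Qed.

Lemma segxx (X : topologicalType) (a : X) : seg a a = [set a].
Proof.
apply/seteqP; split => [z H|z -> //].
by apply: H => //; exact: connected1.
Qed.

Lemma seg_trans (X : topologicalType) (a b y z : X) :
  seg a b y -> seg a y z -> seg a b z.
Proof. by move=> H1 H2 C cC Ca Cb; apply: H2 => //; exact: H1. Qed.

(** Connected sets from [a] to [w] and from [w] to [b], both missing [z], would unite to one from
    [a] to [b] missing [z]. *)
Lemma seg_triangle (X : topologicalType) (w a b z : X) :
  seg a b z -> seg a w z \/ seg w b z.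
Proof.
move=> H; apply: contrapT => /not_orP[].
move=> /existsNP[C /not_implyP[cC /not_implyP[Ca /not_implyP[Cw Cz]]]].
move=> /existsNP[D /not_implyP[cD /not_implyP[Dw /not_implyP[Db Dz]]]].
have : (C `|` D) z.
  apply: H; [|by left|by right].
  by apply: connectedU => //; exists w.
by case.
Qed.

Lemma seg_sub_connected (X : topologicalType) (a b : X) (C : set X) :
  connected C -> C a -> C b -> seg a b `<=` C.
Proof. by move=> cC Ca Cb z; apply. Qed.

(** With [seg_trans], this makes membership of [p] in [seg a q] a partial order with root [a]. The
    initial piece of the arc from [a] to [y] that stops at [z] is connected, so it must contain the
    end [y]. *)
Lemma seg_antisym (R : realType) (X : topologicalType)
    (hP : segs_are_arcs R X) (a y z : X) :
  seg a y z -> seg a z y -> y = z.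
Proof.
move=> zy yz; apply: contrapT => nyz.
have [ay|nay] := pselect (a = y).
  by move: zy; rewrite ay segxx => /esym.
have [h [ch h0 h1 ih E]] := hP _ _ nay.
move: (zy); rewrite E => -[s /=]; rewrite in_itv/= => /andP[s0 s1] hs.
have [t /=] : (h @` `[0, s]) y.
  apply: yz.
  - by apply: connected_image => //; exact: segment_connected.
  - by exists 0 => //=; rewrite in_itv/= lexx.
  - by exists s => //=; rewrite in_itv/= lexx s0.
rewrite in_itv/= => /andP[t0 ts]; rewrite -h1 => /ih.
rewrite !in_itv/= => /(_ _ _) t1.
have {}t1 : t = 1 by apply: t1; rewrite ?ler01 ?lexx// t0 (le_trans ts s1).
apply: nyz; rewrite -h1 -hs; congr h; apply/eqP.
by rewrite eq_le s1 -t1 ts.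
Qed.

Lemma seg_connected (R : realType) (X : topologicalType)
    (hP : segs_are_arcs R X) (a b : X) : connected (seg a b).
Proof.
have [->|nab] := pselect (a = b); first by rewrite segxx; exact: connected1.
have [h [ch h0 h1 ih ->]] := hP _ _ nab.
by apply: connected_image => //; exact: segment_connected.
Qed.

Lemma seg_closed (R : realType) (X : topologicalType) (hX : hausdorff_space X)
    (hP : segs_are_arcs R X) (a b : X) : closed (seg a b).
Proof.
apply: compact_closed => //.
have [->|nab] := pselect (a = b); first by rewrite segxx; exact: compact_set1.
have [h [ch h0 h1 ih ->]] := hP _ _ nab.
by apply: compact_image => //; exact: segment_compact.
Qed.

Lemma compact_unit_circle (R : realType) : compact (@unit_circle R).
Proof.
have -> : @unit_circle R = (`[-1, 1] `*` `[-1, 1]) `&` @unit_circle R.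
  apply/seteqP; split => [[x y] /= xy|p []//].
  split => //; move: xy; rewrite /unit_circle /= => xy.
  by split; rewrite /= in_itv/=; apply/andP; split; nra.
apply: compact_closedI.
  by apply: compact_setX; exact: segment_compact.
have -> : @unit_circle R =
    (fun p : R * R => p.1 ^+ 2 + p.2 ^+ 2) @^-1` [set 1] by [].
apply: preimage_closed; last first.
  by apply: accessible_closed_set1; exact: hausdorff_accessible (@Rhausdorff R).
move=> p _; apply: cvgD; rewrite expr2; apply: cvgM;
  by [exact: cvg_fst|exact: cvg_snd].
Qed.

(** The open upper half of the circle follows [a] and the closed lower half follows [b], the time
    being the abscissa rescaled to [[0, 1]]. *)
Lemma simple_closed_curve_of_arcs (R : realType) (X : topologicalType)
    (a b : R -> X) :
  hausdorff_space X -> continuous a -> continuous b ->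
  {in `[0 : R, 1] &, injective a} -> {in `[0 : R, 1] &, injective b} ->
  a 0 = b 0 -> a 1 = b 1 ->
  (forall s t, 0 <= s <= 1 -> 0 <= t <= 1 -> a s = b t -> s = 0 \/ s = 1) ->
  exists A : set X, is_simple_closed_curve R A.
Proof.
move=> hX ca cb ia ib ab0 ab1 ab.
pose m (p : R * R) := (p.1 + 1) / 2.
have cm : continuous m.
  move=> p; apply: cvgM; last exact: cvg_cst.
  by apply: cvgD; [exact: cvg_fst|exact: cvg_cst].
pose h (p : R * R) := if p.2 <= 0 then b (m p) else a (m p).
have circ p : unit_circle p -> 0 <= m p <= 1.
  by rewrite /unit_circle /m /= => E; apply/andP; split; nra.
have ch : {within @unit_circle R, continuous h}.
  apply: (@continuous_paste R _ _ _ snd (b \o m) (a \o m)).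
  - by move=> p; exact: cvg_snd.
  - by move=> p; exact: (continuous_comp (cm p) (cb _)).
  - by move=> p; exact: (continuous_comp (cm p) (ca _)).
  - move=> [x y]; rewrite /unit_circle /= => + y0; rewrite y0 expr0n addr0.
    move=> /eqP; rewrite sqrf_eq1 => /orP[]/eqP ->; rewrite /m /=.
      by rewrite (_ : (1 + 1) / 2 = 1)//; lra.
    by rewrite addNr mul0r.
(* Strictly above the axis the time is strictly between 0 and 1, where [a] does not meet [b]. *)
have abm p p' : unit_circle p -> unit_circle p' -> 0 < p.2 ->
    a (m p) = b (m p') -> False.
  move=> Cp Cp' p0 /(ab _ _ (circ _ Cp) (circ _ Cp')) H.
  by move: Cp H; rewrite /unit_circle /m /= => Cp []; nra.
have ih : {in @unit_circle R &, injective h}.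
  move=> p p' /set_mem Cp /set_mem Cp'; rewrite /h.
  have inj (c : R -> X) : {in `[0 : R, 1] &, injective c} ->
      c (m p) = c (m p') -> p.1 = p'.1.
    move=> ic /ic; rewrite !in_itv/= => /(_ (circ _ Cp) (circ _ Cp')).
    by rewrite /m; lra.
  have sq : p.1 = p'.1 -> (p.2 - p'.2) * (p.2 + p'.2) = 0.
    by move: Cp Cp'; rewrite /unit_circle /= => Cp Cp' E; rewrite E in Cp; nra.
  case: (leP p.2 0) => p0; case: (leP p'.2 0) => p'0.
  - move=> /(inj _ ib) E; have := sq E; move: p p' p0 p'0 E {Cp Cp' inj sq}.
    move=> [x y] [x' y'] /= y0 y'0 ->.
    move=> /eqP; rewrite mulf_eq0 => /orP[]/eqP H; congr (_, _); lra.
  - by move=> /esym /(abm _ _ Cp' Cp p'0).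
  - by move=> /(abm _ _ Cp Cp' p0).
  - move=> /(inj _ ia) E; have := sq E; move: p p' p0 p'0 E {Cp Cp' inj sq}.
    move=> [x y] [x' y'] /= y0 y'0 ->.
    move=> /eqP; rewrite mulf_eq0 => /orP[]/eqP H; congr (_, _); lra.
have C10 : @unit_circle R !=set0.
  by exists (1, 0); rewrite /unit_circle /= expr1n expr0n addr0.
have [k hk] := compact_homeomorphism_on hX (@compact_unit_circle R) C10 ch ih.
by exists (h @` @unit_circle R), h, k.
Qed.

(* Otherwise an arc avoiding [h s] joins the ends of [h], and together with the
   piece of [h] around [s] between its last and first meeting times with that
   arc it forms a simple closed curve. *)
Lemma arc_separates (R : realType) (X : metricType R) (h : R -> X) (C : set X)
    (s : R) :
  is_dendrite X -> continuous h -> {in `[0 : R, 1] &, injective h} ->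
  0 <= s <= 1 -> connected C -> C (h 0) -> C (h 1) -> C (h s).
Proof.
move=> [[_ cX _] lc ncurve] ch ih s01 cC C0 C1; apply: contrapT => nCs.
have hX : hausdorff_space X by exact: metric_hausdorff.
have inj x y : 0 <= x <= 1 -> 0 <= y <= 1 -> h x = h y -> x = y.
  by move=> x01 y01; apply: ih; rewrite in_itv.
have h01 : h 0 <> h 1.
  by move=> /inj H; have := H ltac:(lra) ltac:(lra); lra.
have oO : open (~` [set h s]).
  by apply: closed_openC; apply: accessible_closed_set1; exact: hausdorff_accessible.
have CO : C `<=` ~` [set h s] by move=> x Cx /= xs; apply: nCs; rewrite -xs.
have [j [cj j0 j1 ij jO]] :=
  path_within_arc h01 (connected_path_within cX lc oO cC CO C0 C1).
have jinj x y : 0 <= x <= 1 -> 0 <= y <= 1 -> j x = j y -> x = y.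
  by move=> x01 y01; apply: ij; rewrite in_itv.
pose K := h @^-1` (j @` `[0, 1]).
have cK : closed K.
  apply: preimage_closed => //; apply: compact_closed => //.
  by apply: compact_image => //; exact: segment_compact.
have K0 : K 0 by exists 0 => //=; rewrite in_itv/= lexx ler01.
have K1 : K 1 by exists 1 => //=; rewrite in_itv/= lexx ler01.
have Ks : ~ K s by move=> [t _ jt]; exact: (jO t).
have /andP[s0 s1] := s01.
have [p [Kp p0 ps pmax]] := closed_last cK K0 s0.
have [q [Kq q1 sq qmin]] := closed_first cK K1 s1.
have {}ps : p < s by rewrite lt_neqAle ps andbT; apply/eqP => E; apply: Ks; rewrite -E.
have {}sq : s < q by rewrite lt_neqAle sq andbT; apply/eqP => E; apply: Ks; rewrite E.
have [p' /= p'01 jp] := Kp; have [q' /= q'01 jq] := Kq.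
rewrite in_itv/= in p'01; rewrite in_itv/= in q'01.
have pq' : p' != q'.
  apply/eqP => E; move: jp; rewrite E jq => /inj H.
  by have := H ltac:(lra) ltac:(lra); lra.
apply: ncurve.
have affc (u v : R) (g : R -> X) : continuous g ->
    continuous (fun t : R => g (u + t * (v - u))).
  move=> cg t; have c2 : {for t, continuous (fun t : R => u + t * (v - u))}.
    apply: cvgD; first exact: cvg_cst.
    by apply: cvgM => //; exact: cvg_cst.
  exact: (continuous_comp c2 (cg _)).
have affi (u v t : R) : 0 <= u <= 1 -> 0 <= v <= 1 -> 0 <= t <= 1 ->
    0 <= u + t * (v - u) <= 1.
  by move=> *; apply/andP; split; nra.
(* Both pieces are rescaled to [[0, 1]]. Possibly [q' < p'], in which case [j] is run backwards;
   only [p' != q'] matters for injectivity. *)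
apply: (@simple_closed_curve_of_arcs R X (fun t => h (p + t * (q - p)))
  (fun t => j (p' + t * (q' - p')))) => //.
- exact: affc.
- exact: affc.
- move=> x y; rewrite !in_itv/= => x01 y01 /inj H.
  have {}H : p + x * (q - p) = p + y * (q - p) by apply: H; apply: affi; lra.
  have qp0 : q - p != 0 by rewrite subr_eq0 gt_eqF// (lt_trans ps).
  by apply: (mulIf qp0); lra.
- move=> x y; rewrite !in_itv/= => x01 y01 /jinj H.
  have {}H : p' + x * (q' - p') = p' + y * (q' - p') by apply: H; exact: affi.
  have qp0 : q' - p' != 0 by rewrite subr_eq0 eq_sym.
  by apply: (mulIf qp0); lra.
- by rewrite !mul0r !addr0 jp.
- by rewrite !mul1r !subrKC jq.
- move=> x y x01 y01 E.
  have Kx : K (p + x * (q - p)).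
    by rewrite /K /= E; exists (p' + y * (q' - p')) => //=; rewrite in_itv/=; exact: affi.
  have [xs|xs] := leP (p + x * (q - p)) s.
    by left; have := pmax _ Kx xs; nra.
  by right; have := qmin _ Kx (ltW xs); nra.
Qed.

Lemma arc_seg (R : realType) (X : metricType R) (h : R -> X) :
  is_dendrite X -> continuous h -> {in `[0 : R, 1] &, injective h} ->
  h @` `[0, 1] = seg (h 0) (h 1).
Proof.
move=> dX ch ih; apply/seteqP; split.
  move=> _ [s /= + <-] C cC C0 C1; rewrite in_itv/= => s01.
  exact: (arc_separates dX ch ih s01 cC C0 C1).
apply: seg_sub_connected.
- by apply: connected_image => //; exact: segment_connected.
- by exists 0 => //=; rewrite in_itv/= lexx ler01.
- by exists 1 => //=; rewrite in_itv/= lexx ler01.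
Qed.

Lemma dendrite_segs_are_arcs (R : realType) (X : metricType R) :
  is_dendrite X -> segs_are_arcs R X.
Proof.
move=> dX a b ab; have [[_ cX kX] lc _] := dX.
have := connected_path_within cX lc openT kX (fun x _ => I) (I : [set: X] a) (I : [set: X] b).
move=> /(path_within_arc ab)[h [ch h0 h1 ih _]].
by exists h; split => //; rewrite arc_seg// h0 h1.
Qed.

Lemma arc_between_seg (R : realType) (X : metricType R) (a b : X) (A : set X) :
  is_dendrite X -> is_arc_between R a b A -> a <> b /\ A = seg a b.
Proof.
move=> dX [h [k [[ch ck hk kh] h0 h1]]].
have c0 : clamp 0 = 0 :> R by rewrite clamp_id// lexx ler01.
have c1 : clamp 1 = 1 :> R by rewrite clamp_id// lexx ler01.
have inj : {in `[0 : R, 1] &, injective h}.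
  move=> x y x01 y01 xy; have [_ <-] := hk x x01; have [_ <-] := hk y y01.
  by rewrite xy.
have icc : {in `[0 : R, 1] &, injective (h \o @clamp R)}.
  move=> x y /[dup] x01 + /[dup] y01; rewrite !in_itv/= => x01' y01'.
  by rewrite /= !clamp_id//; exact: inj.
(* [h] is controlled only on [[0, 1]], whereas [arc_seg] asks for a map continuous on the whole
   line. *)
have hc : continuous (h \o @clamp R).
  move=> t V Vt.
  have c01 : `[0, 1]%classic (clamp t) by rewrite /= in_itv/= clamp_itv.
  have /subspace_continuousP/(_ _ c01 V Vt) /nbhs_ballP[e /= e0 He] := ch.
  exists e => //= s st; apply: He; last by rewrite /= in_itv/= clamp_itv.
  by apply: le_lt_trans st; exact: clamp_contract.
split.
  rewrite -h0 -h1 => /inj; rewrite !in_itv/= !lexx ler01 => /(_ isT isT).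
  by move=> /eqP; rewrite eq_sym oner_eq0.
rewrite -h0 -h1 -[in RHS]c0 -[in X in seg _ X]c1.
rewrite -(arc_seg dX hc icc); apply/seteqP; split => [y Ay|_ [t /= + <-]].
  have [k01 <-] := kh y Ay; exists (k y) => //=.
  by rewrite clamp_id//; move: k01; rewrite /= in_itv.
by move=> t01; rewrite clamp_id//; have [] := hk t t01.
Qed.

Lemma parametrizes_arc_between (R : realType) (X : metricType R) (a b : X)
    (h : R -> X) (A : set X) :
  parametrizes h a b A -> is_arc_between R a b A.
Proof.
move=> [ch h0 h1 ih ->].
have [|||||k hk] := @compact_homeomorphism_on R X `[0, 1]%classic h.
- exact: metric_hausdorff.
- exact: segment_compact.
- by exists 0; rewrite /= in_itv/= lexx ler01.
- exact: continuous_subspaceT.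
- by move=> x y /set_mem x01 /set_mem y01; exact: ih.
by exists h, k.
Qed.

Lemma arc_joining_seg (R : realType) (X : metricType R) (a b : X) :
  is_dendrite X -> arc_joining R a b = seg a b.
Proof.
move=> dX; rewrite /arc_joining; case: eqP => [->|ab]; first by rewrite segxx.
have [h hh] := dendrite_segs_are_arcs dX ab.
case: xgetP => [A _ HA|/(_ (seg a b)) []].
  by have [] := arc_between_seg dX HA.
exact: parametrizes_arc_between hh.
Qed.

Lemma is_arcP (R : realType) (X : metricType R) (A : set X) :
  is_dendrite X -> is_arc R A <-> exists a b, a <> b /\ A = seg a b.
Proof.
move=> dX; split.
  move=> [h [k hk]]; exists (h 0), (h 1).
  by apply: arc_between_seg => //; exists h, k.
move=> [a [b [ab ->]]]; have [h hh] := dendrite_segs_are_arcs dX ab.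
have [h' [k [hk _ _]]] := parametrizes_arc_between hh.
by exists h', k.
Qed.

(** * Fixed points and expanding arcs *)

(** If [z] is off [seg x (g z)], enlarge that arc by a small connected neighbourhood of [g z]. The
    result is connected, contains [x] and [g w] for all [w] near [z], and misses [w]. *)
Lemma closed_seg_map (R : realType) (X : topologicalType) (g : X -> X) (x : X)
    (hH : hausdorff_space X) (lc : is_locally_connected X)
    (hP : segs_are_arcs R X) (cg : continuous g) :
  closed [set z | seg x (g z) z].
Proof.
rewrite -openC openE => z /= nz.
have [U [V [zU gV]]] : exists U V : set X,
    [/\ nbhs z U, nbhs (g z) V & U `&` (seg x (g z) `|` V) = set0].
  have zg : z != g z by apply/eqP => zg; apply: nz; rewrite {2}zg.
  move: (hH); rewrite open_hausdorff => /(_ _ _ zg)[[U V] /= [zU gV] [oU oV UV]].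
  exists (U `&` ~` seg x (g z)), V; split.
  - apply: filterI; first by apply: open_nbhs_nbhs; split => //; exact: set_mem.
    apply: open_nbhs_nbhs; split => //.
    by apply: closed_openC; exact: (seg_closed hH hP).
  - by apply: open_nbhs_nbhs; split => //; exact: set_mem.
  - rewrite setIUr; move/eqP: UV => UV.
    by rewrite -setIA setICl setI0 set0U setIAC UV set0I.
have [W [oW Wg cW WV]] := lc _ _ gV.
move=> UV; near=> w => /= ws.
have /ws : connected (seg x (g z) `|` W).
  apply: connectedU => //; last exact: (seg_connected hP).
  by exists (g z); split => //; exact: seg_right.
have Ww : W (g w).
  by near: w; apply: cg; apply: open_nbhs_nbhs.
move=> /(_ (or_introl (@seg_left _ _ _)) (or_intror Ww)) sw.
suff : set0 w by [].
rewrite -UV; split; first by near: w.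
by case: sw; [left|right; apply: WV].
Unshelve. all: by end_near. Qed.

(** A connected set from [x] to [q] missing [p], enlarged by a small connected neighbourhood of [q],
    does the same for all points near [q]. *)
Lemma closed_seg_up (X : topologicalType) (x p : X)
    (hH : hausdorff_space X) (lc : is_locally_connected X) :
  closed [set q | seg x q p].
Proof.
rewrite -openC openE => q /= /existsNP[C /not_implyP[cC]].
move=> /not_implyP[Cx /not_implyP[Cq Cp]].
have pq : nbhs q (~` [set p]).
  apply: open_nbhs_nbhs; split; last by move=> /= qp; apply: Cp; rewrite -qp.
  by apply: closed_openC; apply: accessible_closed_set1; exact: hausdorff_accessible.
have [W [oW Wq cW Wp]] := lc _ _ pq.
apply: (@filterS _ _ _ W); last exact: open_nbhs_nbhs.
move=> w Ww /= /(_ (C `|` W)) []; [|by left|by right|exact: Cp|by move=> /Wp; exact].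
by apply: connectedU => //; exists q.
Qed.

Lemma nbhs_avoid_closed (X : topologicalType) (x : X) (K : set X) :
  is_locally_connected X -> closed K -> ~ K x ->
  exists W : set X, [/\ open W, W x, connected W & forall w, W w -> ~ K w].
Proof.
move=> lc cK Kx; apply: lc; apply: open_nbhs_nbhs; split => //.
exact: closed_openC.
Qed.

(* A maximal element of {p | y <= p <= g p}, for the order with root x given by
   p <= q iff p is in [seg x q], is a fixed point. *)
Lemma fixed_point_beyond (R : realType) (X : topologicalType) (g : X -> X)
    (hH : hausdorff_space X) (cX : compact [set: X])
    (lc : is_locally_connected X) (hP : segs_are_arcs R X)
    (cg : continuous g) (x y : X) :
  seg x (g y) y -> exists m, g m = m /\ seg x m y.
Proof.
move=> yS.
pose S := [set p | seg x p y /\ seg x (g p) p].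
pose le (p q : {p | S p}) := `[< seg x (sval q) (sval p) >].
have [||||[m [ym mg]] mmax] := @Zorn _ le.
- by move=> p; apply/asboolP.
- by move=> p q r /asboolP pq /asboolP qr; apply/asboolP; exact: (seg_trans qr).
- move=> [p Sp] [q Sq] /asboolP /= pq /asboolP /= qp.
  by apply: eq_exist; exact: (seg_antisym hP qp pq).
- move=> A tA.
  have [->|/set0P[a0 Aa0]] := eqVneq A set0.
    by exists (exist _ y (conj (@seg_right _ x y) yS)).
  (* An upper bound of the chain [A] is a point of [S] above all its members; compactness provides
     it, since these conditions are closed. *)
  pose F := [set (S `&` [set q | seg x q (sval a)]) | a in A].
  have clS : closed S.
    apply: closedI; first exact: closed_seg_up.
    exact: (@closed_seg_map R X g x hH lc hP cg).
  have [|||q Fq] := @compact_chain X setT F cX.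
  + by exists (S `&` [set q | seg x q (sval a0)]), a0.
  + move=> _ [a Aa <-]; split => //.
    * by apply: closedI => //; exact: closed_seg_up.
    * by exists (sval a); split => //; exact: svalP.
  + move=> _ _ [a Aa <-] [b Ab <-].
    case: (tA _ _ Aa Ab) => /asboolP ab; [right|left] => z [Sz bz]; split => //=.
      exact: (seg_trans bz).
    exact: (seg_trans bz).
  + have Sq : S q by have [] := Fq _ (ex_intro2 _ _ a0 Aa0 erefl).
    exists (exist _ q Sq) => a Aa; apply/asboolP => /=.
    by have [] := Fq _ (ex_intro2 _ _ a Aa erefl).
exists m; split; last by [].
(* If [m] moved, a point [h s] slightly further along the arc from [m] to [g m] would still belong
   to [S], against maximality. The first half of that arc holds [h s], while [W] is a neighbourhood
   of [g m] missing that half. *)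
have [//|/nesym gm] := pselect (g m = m).
have [h [ch h0 h1 ih E]] := hP _ _ gm.
have Kg : ~ (h @` `[0, 2^-1]) (g m).
  move=> [t /=]; rewrite in_itv/= => /andP[t0 t2]; rewrite -h1 => /ih.
  by rewrite !in_itv/= => tt; have := tt ltac:(lra) ltac:(lra); lra.
have cK : closed (h @` `[0, 2^-1]).
  apply: compact_closed => //; apply: compact_image => //.
  exact: segment_compact.
have [W [oW Wg cW WK]] := nbhs_avoid_closed lc cK Kg.
have : \forall s \near 0^'+, W (g (h s)).
  apply: cvg_within.
  apply: (continuous_comp (ch 0) (cg _)).
  by rewrite /= h0; exact: open_nbhs_nbhs.
move=> Wnear.
have [s [s0 s2 Ws]] : exists s : R, [/\ 0 < s, s < 2^-1 & W (g (h s))].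
  near ((0:R)^'+) => s; exists s; split; near: s => //.
  - exact: nbhs_right_gt.
  - by apply: nbhs_right_lt; lra.
have hsE : seg m (g m) (h s) by rewrite E; exists s => //=; rewrite in_itv/=; lra.
have hsK : (h @` `[0, 2^-1]) (h s) by exists s => //=; rewrite in_itv/=; lra.
have s01 : s \in `[0, 1] by rewrite in_itv/=; lra.
have hsx : seg x (g m) (h s).
  by rewrite segC; apply: (@seg_trans _ _ _ m); rewrite segC.
have hsg : seg x (g (h s)) (h s).
  (* Otherwise [C], [W] and the second half of the arc would together connect [x] to [g m] without
     [h s], against [hsx]. *)
  move=> C cC Cx Cg; apply: contrapT => Cs.
  pose H := h @` `[2^-1, 1].
  have Hg : H (g m) by exists 1 => //=; rewrite in_itv/=; lra.
  have : (C `|` (W `|` H)) (h s).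
    apply: hsx.
    - apply: connectedU => //; first by exists (g (h s)); split => //; left.
      apply: connectedU => //; first by exists (g m).
      by apply: connected_image => //; exact: segment_connected.
    - by left.
    - by right; left.
  case => //; case; first by move=> /WK.
  move=> [t /=]; rewrite in_itv/= => /andP[t2 t1] /ih.
  by rewrite in_itv/= => /(_ _ s01) => tt; have := tt ltac:(lra); lra.
have mhs : seg x (h s) m.
  case: (seg_triangle (h s) mg) => //.
  rewrite segC => mm; have : m = h s.
    by apply: (seg_antisym hP _ mm); rewrite segC.
  rewrite -h0 => /ih; rewrite in_itv/= => /(_ _ s01) tt.
  by have := tt ltac:(lra); lra.
have Ss : S (h s) by split => //; exact: (seg_trans mhs).
exfalso; have /(congr1 sval) /= := mmax (exist _ _ Ss) (introT (asboolP _) mhs).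
rewrite -[X in _ = X]h0 => /ih => /(_ s01); rewrite in_itv/= => tt.
by have := tt ltac:(lra); lra.
Unshelve. all: by end_near. Qed.

Lemma disconnected_fixed_points (X : topologicalType) (g : X -> X) (p q z : X) :
  g p = p -> g q = q -> g z <> z -> seg p q z -> ~ connected (fixed_points g).
Proof. by move=> gp gq gz sz cF; apply: gz; exact: (sz _ cF). Qed.

(** If every arc between fixed points consisted of fixed points, the fixed point set would be a
    union of arcs from one point, hence connected. A moved point [z] of [seg p q] lies between [g z]
    and one of [p], [q]. *)
Lemma fixed_points_disconnected_pull (R : realType) (X : topologicalType)
    (hP : segs_are_arcs R X) (g : X -> X) :
  ~ connected (fixed_points g) ->
  exists x y, [/\ x = g x, y <> g y & seg x (g y) y].
Proof.
move=> ncF.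
have [p [q [z [gp gq gz zpq]]]] :
    exists p q z, [/\ g p = p, g q = q, g z <> z & seg p q z].
  apply: contrapT => H; apply: ncF.
  have [->|/set0P[p gp]] := eqVneq (fixed_points g) set0; first exact: connected0.
  have -> : fixed_points g = \bigcup_(q in fixed_points g) seg p q.
    apply/seteqP; split => [q gq|z [q gq zpq]]; first by exists q.
    by apply: contrapT => gz; apply: H; exists p, q, z.
  apply: bigcup_connected; first by exists p => q _; exact: seg_left.
  by move=> q _; exact: (seg_connected hP).
case: (seg_triangle (g z) zpq) => H; first by exists p, z; split => // /esym.
by exists q, z; split => //; [move=> /esym|rewrite segC].
Qed.

(** The image of [seg x y] is connected and contains [x] and [g y], hence also [y] and the whole
    arc; [g y] lies strictly beyond [y]. *)
Lemma pull_expanding (R : realType) (X : topologicalType)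
    (hP : segs_are_arcs R X) (g : X -> X) (cg : continuous g) (x y : X) :
  x = g x -> y <> g y -> seg x (g y) y ->
  x <> y /\ seg x y `<` g @` seg x y.
Proof.
move=> gx gy sy; split.
  by move=> xy; apply: gy; rewrite -xy.
split; last first.
  move=> /(_ (g y)) H; apply: gy; apply: (seg_antisym hP _ sy).
  by apply: H; exists y.
move=> z zxy; apply: (seg_trans sy zxy).
- by apply: connected_image => //; exact: (seg_connected hP).
- by exists x.
- by exists y.
Qed.

(** The picture is an arc with [a], [u], [v], [b] in this order, [m1] beyond [v] from [a] and [m2]
    beyond [u] from [b]. If [v] were not between [m2] and [m1], each of [u] and [v] would lie
    between the other and [m2]. *)
Lemma seg_span (R : realType) (X : topologicalType)
    (hP : segs_are_arcs R X) (a b u v m1 m2 : X) :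
  ~ seg a u v -> ~ seg b v u -> seg b m2 u -> seg a m1 v -> seg m2 m1 v.
Proof.
move=> nv nu um vm.
case: (seg_triangle m2 vm) => // /(seg_triangle u)[//|vum].
case: (seg_triangle v um) => // uvm.
exfalso; apply: nv; rewrite (_ : v = u)//.
by apply: (seg_antisym hP (a := m2)); rewrite segC.
Qed.

Lemma param_seg_itv (R : realType) (X : topologicalType) (h : R -> X) (a b : X)
    (A : set X) (p q r : R) :
  parametrizes h a b A -> 0 <= p -> q <= 1 -> 0 <= r <= 1 ->
  seg (h p) (h q) (h r) -> p <= q -> p <= r <= q.
Proof.
move=> [ch h0 h1 ih _] p0 q1 r01 + pq => /(_ (h @` `[p, q])) [].
- by apply: connected_image => //; exact: segment_connected.
- by exists p => //=; rewrite in_itv/= lexx.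
- by exists q => //=; rewrite in_itv/= lexx pq.
move=> r' /=; rewrite in_itv/= => /andP[pr rq] /ih; rewrite !in_itv/= => <- //.
  by rewrite pr.
by rewrite (le_trans p0 pr) (le_trans rq q1).
Qed.

Lemma param_between (R : realType) (X : topologicalType) (h : R -> X) (a b : X)
    (p q r : R) :
  parametrizes h a b (seg a b) -> 0 <= p -> p <= r -> r <= q -> q <= 1 ->
  seg (h p) (h q) (h r).
Proof.
move=> hh p0 pr rq q1; have [ch h0 h1 ih E] := hh.
have : seg a b (h r) by rewrite E; exists r => //=; rewrite in_itv/=; lra.
have [->|npr] := eqVneq r p; first by move=> _; exact: seg_left.
have [->|nqr] := eqVneq r q; first by move=> _; exact: seg_right.
move=> /(seg_triangle (h p))[].
  by rewrite -h0 => /(param_seg_itv hh) H; have := H _ _ _ _; lra.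
move=> /(seg_triangle (h q))[//|].
by rewrite -h1 => /(param_seg_itv hh) H; have := H _ _ _ _; lra.
Qed.

(** There are fixed points [m1] beyond [h t] from [a] and [m2] beyond [h s] from [b], and [s < t]
    puts both [h s] and [h t] between them. If these two are fixed as well, they are [a] and [b],
    and the escaping point [c] separates them. *)
Lemma expanding_preserving (R : realType) (X : topologicalType) (g : X -> X)
    (hH : hausdorff_space X) (cX : compact [set: X])
    (lc : is_locally_connected X) (hP : segs_are_arcs R X)
    (cg : continuous g) (a b c : X) (h : R -> X) (s t : R) :
  parametrizes h a b (seg a b) -> 0 <= s -> s < t -> t <= 1 ->
  g (h s) = a -> g (h t) = b -> seg a b c -> ~ seg a b (g c) ->
  ~ connected (fixed_points g).
Proof.
move=> hh s0 st t1 gs gt sc ngc; have [ch h0 h1 ih E] := hh.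
have nt : ~ seg a (h s) (h t).
  by rewrite -h0 => /(param_seg_itv hh) H; have := H _ _ _ _; lra.
have ns : ~ seg b (h t) (h s).
  by rewrite -h1 segC => /(param_seg_itv hh) H; have := H _ _ _ _; lra.
have [m1 [gm1 sm1]] : exists m, g m = m /\ seg a m (h t).
  apply: (fixed_point_beyond hH cX lc hP cg).
  by rewrite gt E; exists t => //=; rewrite in_itv/=; lra.
have [m2 [gm2 sm2]] : exists m, g m = m /\ seg b m (h s).
  apply: (fixed_point_beyond hH cX lc hP cg).
  by rewrite gs segC E; exists s => //=; rewrite in_itv/=; lra.
have [gt'|] := pselect (g (h t) = h t); last first.
  by move=> /disconnected_fixed_points; apply; [exact: gm2|exact: gm1|exact: (seg_span hP nt ns)].
have [gs'|] := pselect (g (h s) = h s); last first.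
  move=> /disconnected_fixed_points; apply; [exact: gm1|exact: gm2|].
  exact: (seg_span hP ns nt).
apply: (@disconnected_fixed_points _ g a b c) => //.
- by rewrite -{1}gs gs' gs.
- by rewrite -{1}gt gt' gt.
- by move=> gc; apply: ngc; rewrite gc.
Qed.

(** At time [r] the point [h r] is the projection of its image to the arc. The two conditions are
    closed, cover [[t, s]] by [seg_triangle], and hold at [t] and at [s] respectively, so by
    connectedness they hold together somewhere. *)
Lemma param_fixed_projection (R : realType) (X : topologicalType) (g : X -> X)
    (hH : hausdorff_space X) (lc : is_locally_connected X)
    (hP : segs_are_arcs R X) (cg : continuous g) (a b : X) (h : R -> X)
    (s t : R) :
  parametrizes h a b (seg a b) -> 0 <= t -> t <= s -> s <= 1 ->
  g (h s) = a -> g (h t) = b ->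
  exists r, [/\ t <= r, r <= s, seg a (g (h r)) (h r) & seg b (g (h r)) (h r)].
Proof.
move=> hh t0 ts s1 gs gt; have [ch h0 h1 ih E] := hh.
apply: contrapT => H.
have clP x : closed (h @^-1` [set z | seg x (g z) z]).
  by apply: preimage_closed => //; exact: (closed_seg_map hH lc hP cg).
pose B := `[t, s]%classic `&` h @^-1` [set z | seg a (g z) z].
have /(_ B) := @segment_connected R t s.
have Et r : `[t, s]%classic r -> seg a b (h r).
  by rewrite /= in_itv/= => ?; rewrite E; exists r => //=; rewrite in_itv/=; lra.
have tB : B t.
  split; first by rewrite /= in_itv/=; lra.
  by rewrite /= gt; apply: Et; rewrite /= in_itv/=; lra.
have EB : B = `[t, s]%classic `&` ~` (h @^-1` [set z | seg b (g z) z]).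
  apply/seteqP; split => r [rts Hr]; split => //.
    move=> Hb; apply: H; exists r; move: rts; rewrite /= in_itv/= => /andP[? ?].
    by split.
  have := Et _ rts; move=> /(seg_triangle (g (h r)))[//|].
  by rewrite segC => /Hr.
move=> /(_ (ex_intro _ t tB)) HB.
have : B = `[t, s]%classic.
  apply: HB.
    by exists (~` (h @^-1` [set z | seg b (g z) z])) => //; exact: closed_openC.
  by exists (h @^-1` [set z | seg a (g z) z]).
have : `[t, s]%classic s by rewrite /= in_itv/= lexx ts.
move=> /[swap] <-; rewrite EB => -[sts]; apply.
by rewrite /= gs segC; exact: Et.
Qed.

Lemma expanding_disconnected (R : realType) (X : topologicalType) (g : X -> X)
    (hH : hausdorff_space X) (cX : compact [set: X])
    (lc : is_locally_connected X) (hP : segs_are_arcs R X)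
    (cg : continuous g) (a b : X) :
  a <> b -> seg a b `<` g @` seg a b ->
  ~ connected (fixed_points g) \/ ~ connected (fixed_points (g \o g)).
Proof.
move=> nab [sub /existsNP[_ /not_implyP[[c sc <-] ngc]]].
have [h hh] := hP _ _ nab; have [ch h0 h1 ih E] := hh.
have [u] := sub _ (@seg_left _ a b); rewrite {1}E => -[s /=].
rewrite in_itv/= => /andP[s0 s1] <- gs {u}.
have [v] := sub _ (@seg_right _ a b); rewrite {1}E => -[t /=].
rewrite in_itv/= => /andP[t0 t1] <- gt {v}.
case: (ltgtP s t) => [st|ts|st]; last by case: nab; rewrite -gs -gt st.
  by left; exact: (expanding_preserving hH cX lc hP cg hh s0 st t1 gs gt sc).
right.
(* [r] separates the new times: [g] carries [[t, r]] over the part of the arc from [b] to [h r],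
   which contains [h s], and [[r, s]] over the part from [a] to [h r], which contains [h t]. So
   [g \o g] reaches [a] no later than [r] and [b] no earlier. *)
have [r [tr rs ra rb]] := param_fixed_projection hH lc hP cg hh t0 (ltW ts) s1 gs gt.
have sub_image (p q : R) (x y z : X) : seg y z x -> ((g \o h) @` `[p, q]) y ->
    ((g \o h) @` `[p, q]) z -> exists2 r', p <= r' <= q & g (h r') = x.
  move=> H Hy Hz; have [||//|r'] := H ((g \o h) @` `[p, q]) => //.
    apply: connected_image; last exact: segment_connected.
    by move=> w; exact: (continuous_comp (ch w) (cg _)).
  by rewrite /= in_itv/= => ? <-; exists r'.
have [s' ss' gs'] : exists2 s', t <= s' <= r & g (h s') = h s.
  apply: (sub_image _ _ _ b (g (h r))); last 2 first.
  - by exists t => //=; rewrite in_itv/= lexx tr.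
  - by exists r => //=; rewrite in_itv/= lexx tr.
  apply: (seg_trans rb); rewrite segC -h1.
  by apply: (param_between hh); lra.
have [t' tt' gt'] : exists2 t', r <= t' <= s & g (h t') = h t.
  apply: (sub_image _ _ _ a (g (h r))); last 2 first.
  - by exists s => //=; rewrite in_itv/= lexx rs.
  - by exists r => //=; rewrite in_itv/= lexx rs.
  apply: (seg_trans ra); rewrite -h0.
  by apply: (param_between hh); lra.
(* A preimage of [c] in the arc escapes under the second iterate. *)
have [c' sc' gc'] := sub _ sc.
have cgg : continuous (g \o g).
  by move=> w; exact: (continuous_comp (cg w) (cg _)).
apply: (expanding_preserving hH cX lc hP cgg hh (s := s') (t := t') (c := c')) => //=.
- by lra.
- have : s' != t'.
    apply/eqP => st'; move: gs'; rewrite st' gt' => /ih.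
    by rewrite !in_itv/= => H; have := H ltac:(lra) ltac:(lra); lra.
  by rewrite neq_lt => /orP[//|]; lra.
- by lra.
- by rewrite gs'.
- by rewrite gt'.
- by rewrite gc'.
Qed.

Theorem lemma2p9 (R : realType) (X : metricType R) (f : X -> X)
    (hX : is_dendrite X) (hf : continuous f) :
  [<-> exists A : set X, is_expanding_arc R f A;
       exists n : nat, (0 < n)%N /\ ~ connected (fixed_points (iter n f));
       exists (x y : X) (n : nat),
         [/\ (0 < n)%N, x = iter n f x, y <> iter n f y &
             arc_joining R x (iter n f y) y]].
Proof.
have [[_ cX _] lc _] := hX.
have hH : hausdorff_space X by exact: metric_hausdorff.
have hP := dendrite_segs_are_arcs hX.
tfae.
- move=> [A [/(is_arcP A hX)[a [b [ab ->]]] [n [n0 expA]]]].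
  have cg : continuous (iter n f) by exact: iter_continuous.
  have [H|H] := expanding_disconnected hH cX lc hP cg ab expA.
    by exists n.
  exists (n + n)%N; split; first by rewrite addn_gt0 n0.
  suff <- : iter n f \o iter n f = iter (n + n) f by [].
  by apply/funext => x /=; rewrite iterD.
- move=> [n [n0 /(fixed_points_disconnected_pull hP)[x [y [fx fy sxy]]]]].
  by exists x, y, n; split => //; rewrite arc_joining_seg.
- move=> [x [y [n [n0 fx fy]]]]; rewrite arc_joining_seg// => sxy.
  have [xy ex] := pull_expanding hP (@iter_continuous _ _ n hf) fx fy sxy.
  exists (seg x y); split; first by apply/is_arcP => //; exists x, y.
  by exists n.
Qed.
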